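(* Let $A$ be an algebra generated by a linear subspace $V\subseteq A$, let $K\subseteq X(A)$ be closed, and let $J:=\{\langle W\rangle: W\text{ finite dimensional subspace of }V\}$. Let $L:A\to\mathbb{R}$ be a linear functional with $L(1)=1$ and $L(a^2)\ge0$ for all $a\in A$, let $Q$ be a quadratic module in $A$ such that $K=K_Q$, and let $s_L(a):=\sqrt{L(a^2)}$ for $a\in A$. Suppose that there exists a Hilbertian seminorm $q$ on $V$ such that $\mathrm{tr}(s_L\restriction_V/q)<\infty$ and $M:=\{\alpha\in K:\alpha\restriction_V\text{ is }q\text{-continuous}\}\neq\emptyset$, and that for each $S\in J$ there exists a representing Radon measure $\nu_S$ for $L\restriction_S$ on $X(S)$ with support contained in $K_{Q\cap S}$. Then there exists a representing Radon measure $\nu$ for $L$ on $X(A)$ with $\nu(X(A)\setminus M)=0$.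
   Context: Algebras are unital commutative $\mathbb{R}$-algebras (not necessarily finitely generated). For an algebra $A$, the character space $X(A)$ is the set of all $\mathbb{R}$-algebra homomorphisms $A\to\mathbb{R}$; it is assumed non-empty and carries the weakest topology making all maps $\hat a:X(A)\to\mathbb{R}$, $\hat a(\alpha)=\alpha(a)$ ($a\in A$), continuous, and its Borel $\sigma$-algebra. $A$ is generated by a linear subspace $V$ if $V$ contains a set of generators of $A$; $\langle W\rangle$ is the subalgebra of $A$ generated by $W$. A Radon measure is a non-negative Borel measure that is locally finite and inner regular with respect to compact sets; its support is the smallest closed set with null complement. A representing Radon measure for a linear functional $L$ on $A$ is a Radon measure $\nu$ on $X(A)$ with $L(a)=\int_{X(A)}\hat a\,d\nu$ for all $a\in A$ (analogously for $S\in J$ and $X(S)$). A quadratic module in $A$ is a subset $Q\subseteq A$ with $1\in Q$, $Q+Q\subseteq Q$ and $a^2Q\subseteq Q$ for all $a\in A$; $K_Q:=\{\alpha\in X(A):\alpha(a)\ge0\ \forall a\in Q\}$. For a subalgebra $S$, $K_{Q\cap S}:=\{\alpha\in X(S):\alpha(a)\ge 0\ \forall a\in Q\cap S\}$. A seminorm $p$ on a real vector space is Hilbertian if $p(v)=\sqrt{\langle v,v\rangle_p}$ for a (necessarily unique) symmetric positive semidefinite bilinear form $\langle\cdot,\cdot\rangle_p$; $s_L$ is Hilbertian, induced by $(a,b)\mapsto L(ab)$. A linear functional $l$ on $V$ is $q$-continuous if $|l(v)|\le Cq(v)$ for all $v\in V$, for some $C>0$. For Hilbertian seminorms $p,q$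 on $V$, $\mathrm{tr}(p/q):=\sup_E\sum_{e\in E}p(e)^2$ over all finite $q$-orthonormal subsets $E\subseteq V$ if $\ker(q)\subseteq\ker(p)$, and $\mathrm{tr}(p/q):=\infty$ otherwise. *)

(* Defs.v *)
From HB Require Import structures.
From mathcomp Require Import all_boot all_order all_algebra.
From mathcomp Require Import all_classical all_reals all_analysis.

Set Implicit Arguments.
Unset Strict Implicit.
Unset Printing Implicit Defensive.

Import Order.TTheory GRing.Theory Num.Theory.
Import numFieldNormedType.Exports.

Local Open Scope classical_set_scope.
Local Open Scope ring_scope.

Section SubModule.
Context (R : realType) (A : lmodType R) (V : submodClosed A).

Definition submod_type : Type := {x : A | x \in V}.

HB.instance Definition _ := SubChoice.on submod_type.
HB.instance Definition _ := [SubChoice_isSubLmodule of submod_type by <:].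

End SubModule.

Section SubAlgebra.
Context (R : realType) (A : comAlgType R) (S : subalgClosed A).

Definition subalg_type : Type := {x : A | x \in S}.

HB.instance Definition _ := SubChoice.on subalg_type.
HB.instance Definition _ := [SubChoice_isSubAlgebra of subalg_type by <:].
HB.instance Definition _ :=
  GRing.SubPzRing_isSubComPzRing.Build A _ subalg_type.

End SubAlgebra.

Section GeneratedSubalgebra.
Context (R : realType) (A : comAlgType R).

Definition gen_subalg (W : set A) : {pred A} :=
  [in smallest [set S : set A | subalg_closed [in S]] W].

Lemma gen_subalg_closed (W : set A) : subalg_closed (gen_subalg W).
Proof.
split.
- by apply/mem_set => S [[S1 _ _] _]; exact/set_mem.
- move=> c a b /set_mem Wa /set_mem Wb; apply/mem_set => S [[/= S1 SL SM] WS].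
  by apply/set_mem/SL; apply/mem_set; [exact: Wa | exact: Wb].
- move=> a b /set_mem Wa /set_mem Wb; apply/mem_set => S [[/= S1 SL SM] WS].
  by apply/set_mem/SM; apply/mem_set; [exact: Wa | exact: Wb].
Qed.

HB.instance Definition _ (W : set A) :=
  GRing.isSubalgClosed.Build R A (gen_subalg W)
    (gen_subalg_closed W).

Definition generated_by (V : {pred A}) : Prop :=
  exists2 G : set A, G `<=` [set` V] & forall a, a \in gen_subalg G.

Definition findim_subspace (W : set A) : Prop :=
  submod_closed [in W] /\
  exists2 s : seq A, [set` s] `<=` W &
    forall w, W w ->
      exists c : 'I_(size s) -> R, w = \sum_(i < size s) c i *: s`_i.

Definition fg_subalgs (V : {pred A}) : set (subalgClosed A) :=
  [set (gen_subalg W : subalgClosed A) |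
    W in [set W | findim_subspace W /\ W `<=` [set` V]]].

End GeneratedSubalgebra.

Section CharacterSpace.
Context (R : realType).

Definition character (A : comAlgType R) : Type := {lrmorphism A -> R | *%R}.

Definition hat (A : comAlgType R) (a : A) (alpha : character A) : R := alpha a.

HB.instance Definition _ (A : comAlgType R) := gen_eqMixin (character A).
HB.instance Definition _ (A : comAlgType R) := gen_choiceMixin (character A).
HB.instance Definition _ (A : comAlgType R) :=
  Topological.copy (character A)
    (sup_topology (fun a : A => Topological.class (initial_topology (hat a)))).

(* The restriction map X(A) -> X(S). *)
Definition res_fun (A : comAlgType R) (S : subalgClosed A)
    (alpha : character A) (a : subalg_type S) : R := hat (val a) alpha.

HB.instance Definition _ (A : comAlgType R) (S : subalgClosed A)
    (alpha : {lrmorphism A -> R | *%R}) :=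
  GRing.RMorphism.copy (@res_fun A S alpha)
    (alpha \o (val : subalg_type S -> A)).
HB.instance Definition _ (A : comAlgType R) (S : subalgClosed A)
    (alpha : {lrmorphism A -> R | *%R}) :=
  GRing.Linear.copy (@res_fun A S alpha)
    (alpha \o (val : subalg_type S -> A)).

Definition res_character (A : comAlgType R) (S : subalgClosed A)
    (alpha : character A) : character (subalg_type S) :=
  @res_fun A S alpha : {lrmorphism subalg_type S -> R | *%R}.

End CharacterSpace.

(* Measurable types are pointed in the library, hence the base point x0, which
   witnesses that T is non-empty; nothing else depends on it. *)
Definition pointed_at (T : Type) (x0 : T) : Type := T.

HB.instance Definition _ (T : topologicalType) (x0 : T) :=
  Topological.on (pointed_at x0).
HB.instance Definition _ (T : topologicalType) (x0 : T) :=
  isPointed.Build (pointed_at x0) x0.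

Definition borel (T : topologicalType) (x0 : T) : Type :=
  g_sigma_algebraType (@open (pointed_at x0)).

HB.instance Definition _ (T : topologicalType) (x0 : T) :=
  Measurable.on (borel x0).

Section Radon.
Context (R : realType) (T : topologicalType) (x0 : T).
Implicit Type nu : {measure set (borel x0) -> \bar R}.

Definition locally_finite nu : Prop :=
  forall x : T, exists2 U : set T, open_nbhs x U & (nu U < +oo)%E.

(* Meant for Hausdorff spaces such as [character A], whose compact sets are
   Borel. *)
Definition inner_regular nu : Prop :=
  forall B : set (borel x0), measurable B ->
    nu B = ereal_sup [set nu C | C in [set C : set T | compact C /\ C `<=` B]].

Definition radon nu : Prop := locally_finite nu /\ inner_regular nu.

(* The intersection of all closed sets with null complement; it has itself null
   complement when nu is Radon, by inner regularity. *)
Definition supp nu : set T :=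
  smallest [set F : set T | closed F /\ nu (~` F) = 0%E] set0.

End Radon.

(* Integrability is already forced by the finiteness of the integral. *)
Definition representing (R : realType) (A : comAlgType R) (x0 : character A)
    (L : A -> R) (nu : {measure set (borel x0) -> \bar R}) : Prop :=
  forall a : A,
    nu.-integrable setT (EFin \o hat a) /\
    (L a)%:E = (\int[nu]_alpha (hat a alpha)%:E)%E.

Section QuadraticModule.
Context (R : realType) (A : comAlgType R).

Definition quadratic_module (Q : set A) : Prop :=
  [/\ Q 1,
      forall a b, Q a -> Q b -> Q (a + b)
    & forall a b, Q b -> Q (a ^+ 2 * b)].

Definition K_of (Q : set A) : set (character A) :=
  [set alpha | forall a, Q a -> 0 <= hat a alpha].

Definition s_of (L : A -> R) (a : A) : R := Num.sqrt (L (a ^+ 2)).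

End QuadraticModule.

Section Hilbertian.
Context (R : realType) (V : lmodType R).
Implicit Types (p q : V -> R) (B : {biscalar V}).

Definition induces B p : Prop :=
  [/\ forall u v, B u v = B v u,
      forall v, 0 <= B v v
    & forall v, p v = Num.sqrt (B v v)].

(* That such a [p] is a seminorm follows from the Cauchy-Schwarz inequality. *)
Definition hilbertian p : Prop := exists B, induces B p.

Definition orthonormal q (E : set V) : Prop :=
  exists2 B, induces B q &
    forall e f, E e -> E f -> B e f = (e == f)%:R.

Definition tr p q : \bar R :=
  if `[< forall v, q v = 0 -> p v = 0 >] then
    ereal_sup [set (\sum_(e \in E) (p e) ^+ 2)%:E |
                E in [set E : set V | finite_set E /\ orthonormal q E]]
  else +oo%E.

Definition seminorm_continuous q (l : V -> R) : Prop :=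
  exists2 C : R, 0 < C & forall v, `|l v| <= C * q v.

End Hilbertian.

Definition continuous_characters (R : realType) (A : comAlgType R)
    (V : submodClosed A) (K : set (character A)) (q : submod_type V -> R) :
    set (character A) :=
  [set alpha | K alpha /\
    seminorm_continuous q (fun v : submod_type V => hat (val v) alpha)].

(* Main.v *)
Require Import Defs.
From HB Require Import structures.
From mathcomp Require Import all_boot all_order all_algebra.
From mathcomp Require Import all_classical all_reals all_analysis.
From mathcomp Require Import measurable_realfun lra.

(** The measure is a limit of the given measures nu_S, although these need not
    be compatible with each other.  Characters of the subalgebras S are extended
    by zero to points of the product space of all functions from A to R, so that
    all nu_S become measures on one Hausdorff space, and for an open subset U of
    that space m(U) is defined as the limit of nu_S(U) along an ultrafilter on
    the finite lists of elements of V that refines inclusion.  This m is only a finitely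
    additive content on open sets.  It comes from a Radon measure on X(A) as soon
    as it is tight: for each e > 0 there is a compact subset D of X(A) such that
    every open U containing D has m(U) >= 1 - e ([radon_of_content]).

    Tightness is where the Hilbertian seminorm enters.  Gram-Schmidt gives a
    basis of a finite dimensional subspace of V made of q-orthonormal vectors
    e_i and q-null vectors z_j.  Since q(v) = 0 forces L(v^2) = 0, nu_S-almost
    every character beta vanishes on the z_j, and the dual q-norm of beta on the
    subspace is then the square root of the sum of the beta(e_i)^2, which has
    nu_S-mean at most t = tr(s_L / q).  By the Markov inequality this norm exceeds
    r with probability at most t / r^2, a bound that does not depend on S
    ([span_tightness]).  The characters of A in K_Q that are bounded by r q on V
    form a compact set D_r, since V generates A, and an ultralimit of characters
    of the algebras S that are nonnegative on Q and bounded by r q is a point of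
    D_r ([ultralimit_character]).  Hence, for almost all S, an open set U around
    D_r contains all these characters of S, and m(U) >= 1 - t / r^2.

    The limit mu satisfies mu(U) <= m(U) for open U, which gives only an
    inequality between integrals: the mean of c^2 under mu is at most L(c^2), for
    every c in A.  Applied to c = a + s with s an arbitrary real number this is a
    polynomial inequality in s whose linear coefficients must agree, that is, the
    mean of a is L(a) ([representing_of_squares]).  Finally mu(D_n) tends to 1 and
    the union of the D_n is the set M of q-continuous characters in K. *)

Set Implicit Arguments.
Unset Strict Implicit.
Unset Printing Implicit Defensive.

Import Order.TTheory GRing.Theory Num.Theory.
Import numFieldNormedType.Exports.

Local Open Scope classical_set_scope.
Local Open Scope ring_scope.

(** * Compact subsets of Hausdorff spaces *)

Section CompactSets.
Context {T : topologicalType}.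
Hypothesis T2 : hausdorff_space T.

Lemma separate_point_compact (x : T) (D : set T) :
  compact D -> ~ D x ->
  exists U W, [/\ open U, open W, U x, D `<=` W & U `&` W = set0].
Proof.
move=> cD nDx.
(* near coverings replace finite subcovers: the property below holds for all
   small enough neighbourhoods U of x, uniformly in the points of D *)
have /compact_near_coveringP/(_ (set T) (powerset_filter_from (nbhs x))
    (fun U y => exists W, [/\ open W, W y & U `&` W = set0])) := cD.
case=> [y Dy|].
  have /eqP xy : x <> y by move=> xy; apply: nDx; rewrite xy.
  move: T2; rewrite open_hausdorff => /(_ _ _ xy)[[U W]/=].
  rewrite !inE => -[Ux Wy] [oU oW UW0].
  exists (W, [set V | nbhs x V /\ V `<=` U]) => /=.
    split; first exact: open_nbhs_nbhs.
    apply: (@powerset_filter_fromP _ (nbhs x)) => //; exact: open_nbhs_nbhs.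
  move=> [z V] /= [Wz [_ VU]]; exists W; split=> //.
  by apply: subsetI_eq0 UW0.
move=> M [Msub _ [U MU]] /(_ U MU) DU.
have [U' [oU' U'x] U'U] : exists2 U', open_nbhs x U' & U' `<=` U.
  by have /Msub := MU; rewrite nbhsE => -[U' ? ?]; exists U'.
exists U', (\bigcup_(W in [set W | open W /\ U `&` W = set0]) W); split=> //.
- by apply: bigcup_open => W [].
- by move=> y /DU[W [oW Wy UW0]]; exists W.
- rewrite -subset0 => y [U'y [W [_ UW0] Wy]].
  by rewrite -UW0; split=> //; exact: U'U.
Qed.

Lemma separate_compacts (C D : set T) :
  compact C -> compact D -> C `&` D = set0 ->
  exists U W, [/\ open U, open W, C `<=` U, D `<=` W & U `&` W = set0].
Proof.
move=> cC cD CD0.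
have [->|/set0P D0] := eqVneq D set0.
  exists setT, set0; split=> //; [exact: openT | exact: open0 |].
  by rewrite setI0.
have ? := powerset_filter_from_filter (set_nbhs_pfilter D0).
have /compact_near_coveringP/(_ (set T) (powerset_filter_from (set_nbhs D))
    (fun W y => exists U, [/\ open U, U y & U `&` W = set0])) := cC.
case=> [y Cy|].
  have nDy : ~ D y by move=> Dy; suff: (C `&` D) y by rewrite CD0.
  have [U [W [oU oW Uy DW UW0]]] := separate_point_compact cD nDy.
  exists (U, [set V | set_nbhs D V /\ V `<=` W]) => /=.
    split; first exact: open_nbhs_nbhs.
    have DW' : set_nbhs D W by apply/set_nbhsP; exists W; split.
    exact: (powerset_filter_fromP (F := set_nbhs D)).
  move=> [z V] /= [Uz [_ VW]]; exists U; split=> //.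
  by apply: subsetI_eq0 UW0.
move=> M [Msub _ [W MW]] /(_ W MW) CW.
have /set_nbhsP[W' [oW' DW' W'W]] : set_nbhs D W by exact: Msub.
exists (\bigcup_(U in [set U | open U /\ U `&` W = set0]) U), W'; split=> //.
- by apply: bigcup_open => U [].
- by move=> y /CW[U [oU Uy UW0]]; exists U.
- rewrite -subset0 => y [[U [_ UW0] Uy] W'y].
  by rewrite -UW0; split=> //; exact: W'W.
Qed.

(** Compactness makes the outer approximation of compact sets by open sets
    continuous along countable intersections. *)
Lemma bigcap_compact_sub_open (C : nat -> set T) (U : set T) :
  (forall i, compact (C i)) -> open U -> \bigcap_i C i `<=` U ->
  exists n, \bigcap_(i < n.+1) C i `<=` U.
Proof.
move=> cC oU CU.
have /compact_near_coveringP/(_ _ \oo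
    (fun n x => (\bigcap_(i < n.+1) C i) x -> U x)) := cC 0%N.
case=> [x _|n _ /(_ n (leqnn n)) nU]; last first.
  by exists n => x Cx; apply: (nU x) => //; exact: Cx.
have [Ux|nUx] := pselect (U x).
  exists (U, setT) => /=; last by move=> [y k] /= [].
  by split; [exact: open_nbhs_nbhs | exact: filterT].
have [k nCkx] : exists k, ~ C k x.
  by apply/existsNP => Cx; apply: nUx; apply: CU => i _.
exists (~` C k, [set n | (k <= n)%N]) => /=.
  split; last by exists k.
  apply: open_nbhs_nbhs; split=> //.
  by apply: closed_openC; apply: compact_closed.
by move=> [y n] /= [nCky kn] /(_ k) /=; rewrite ltnS => /(_ kn).
Qed.

End CompactSets.

(** * Radon measures from contents on open sets *)

(** The content m lives on the open subsets of a larger space Y, because it will be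
    a limit of measures that charge points of Y outside T.  Its countable
    subadditivity is recovered from the compactness of the sets in T that carry
    the mass. *)
Section RadonFromContent.
Context (R : realType) (T Y : topologicalType) (x0 : T) (iota : T -> Y).
Context (m : set Y -> R).
Hypothesis Y2 : hausdorff_space Y.
Hypothesis iota_cont : continuous iota.
Hypothesis iota_inj : injective iota.
Hypothesis m_ge0 : forall U, open U -> 0 <= m U.
Hypothesis m_set0 : m set0 = 0.
Hypothesis m_le1 : forall U, open U -> m U <= 1.
Hypothesis m_modular : forall U W, open U -> open W ->
  m (U `|` W) + m (U `&` W) = m U + m W.
Hypothesis m_tight : forall e, 0 < e -> exists2 D : set T, compact D &
  forall U, open U -> D `<=` iota @^-1` U -> 1 - e <= m U.

Let T2 : hausdorff_space T.
Proof.
rewrite open_hausdorff => x y xy.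
have ixy : iota x != iota y by apply: contra_neq xy; exact: iota_inj.
move: Y2; rewrite open_hausdorff => /(_ _ _ ixy)[[U W]/=].
rewrite !inE => -[Ux Wy] [oU oW UW0].
exists (iota @^-1` U, iota @^-1` W) => /=; first by rewrite !inE.
split; [exact: open_comp|exact: open_comp|].
by rewrite -preimage_setI UW0 preimage_set0.
Qed.

Let iota_open U : open U -> open (iota @^-1` U).
Proof. by move=> oU; apply: open_comp. Qed.

Definition outer_content (C : set T) : R :=
  inf [set m U | U in [set U | open U /\ C `<=` iota @^-1` U]].

Local Notation lam := outer_content.

Let lam_has_inf C :
  has_inf [set m U | U in [set U | open U /\ C `<=` iota @^-1` U]].
Proof.
split; first by exists (m setT), setT => //; split; [exact: openT|].
by exists 0 => _ [U [oU _] <-]; exact: m_ge0.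
Qed.

Lemma outer_content_le C U : open U -> C `<=` iota @^-1` U -> lam C <= m U.
Proof. by move=> oU CU; apply: ge_inf; [exact: (lam_has_inf C).2|exists U]. Qed.

Lemma outer_content_ge C c :
  (forall U, open U -> C `<=` iota @^-1` U -> c <= m U) -> c <= lam C.
Proof.
move=> h; apply: lb_le_inf; first exact: (lam_has_inf C).1.
by move=> _ [U [oU CU] <-]; exact: h.
Qed.

Lemma outer_content_approx C e : 0 < e ->
  exists U, [/\ open U, C `<=` iota @^-1` U & m U < lam C + e].
Proof.
by move=> /inf_adherent /(_ (lam_has_inf C))[_ [U [oU CU] <-] mU]; exists U.
Qed.

Let lam_ge0 C : 0 <= lam C.
Proof. by apply: outer_content_ge => U oU _; exact: m_ge0. Qed.

Let lam_le1 C : lam C <= 1.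
Proof. by apply: (le_trans (outer_content_le openT _)) => //; exact/m_le1/openT. Qed.

Let lam_tight e : 0 < e -> exists2 D, compact D & 1 - e <= lam D.
Proof.
by move=> /m_tight[D cD mD]; exists D => //; exact: outer_content_ge.
Qed.

Let compact_setD_preim C U : compact C -> open U -> compact (C `\` iota @^-1` U).
Proof.
move=> cC oU; apply: (subclosed_compact _ cC); last by move=> x [].
by apply: closedI; [exact: compact_closed | apply: open_closedC; exact: iota_open].
Qed.

(** Separating the parts of C and D outside a neighbourhood U of their
    intersection enlarges C and D to open sets that meet only inside U. *)
Lemma outer_content_setI C D : compact C -> compact D ->
  lam C + lam D <= 1 + lam (C `&` D).
Proof.
move=> cC cD; apply/ler_addgt0Pr => e e0.
have [U [oU CDU mU]] := outer_content_approx (C `&` D) e0.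
have cimg (B : set T) : compact B -> compact (iota @` B).
  by move=> cB; apply: continuous_compact => //; exact: continuous_subspaceT.
have [G [H [oG oH CG DH GH0]]] : exists G H, [/\ open G, open H,
    iota @` (C `\` iota @^-1` U) `<=` G, iota @` (D `\` iota @^-1` U) `<=` H &
    G `&` H = set0].
  apply: (separate_compacts Y2).
  - exact/cimg/compact_setD_preim.
  - exact/cimg/compact_setD_preim.
  - rewrite -subset0 => _ [[x [Cx nUx] <-] [y [Dy _] /iota_inj yx]].
    by apply: nUx; apply: CDU; split=> //; rewrite -yx.
have sub (B W : set _) : iota @` (B `\` iota @^-1` U) `<=` W ->
    B `<=` iota @^-1` (W `|` U).
  move=> BW x Bx; have [Ux|nUx] := pselect (U (iota x)); first by right.
  by left; apply: BW; exists x.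
have lC : lam C <= m (G `|` U).
  by apply: outer_content_le; [exact: openU | exact: sub].
have lD : lam D <= m (H `|` U).
  by apply: outer_content_le; [exact: openU | exact: sub].
have := m_modular (openU oG oU) (openU oH oU).
rewrite -setUIl GH0 set0U => GHU.
have l1 := m_le1 (openU (openU oG oU) (openU oH oU)).
rewrite (le_trans (lerD lC lD))// -GHU -addrA lerD// ltW//.
Qed.

Lemma outer_content_bigcap (C : nat -> set T) e : (forall i, compact (C i)) ->
  0 < e -> exists n, lam (\bigcap_(i < n.+1) C i) <= lam (\bigcap_i C i) + e.
Proof.
move=> cC e0; have [U [oU CU mU]] := outer_content_approx (\bigcap_i C i) e0.
have [n nU] := bigcap_compact_sub_open T2 cC (iota_open oU) CU.
by exists n; apply: (le_trans (outer_content_le oU nU)); exact: ltW.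
Qed.

(** The key to the measurability of closed sets.  A compact set B that carries
    almost all of the mass is cut along F; the piece outside F is what an almost
    optimal open neighbourhood U of the piece inside F leaves uncovered. *)
Lemma outer_content_split C F e : compact C -> closed F -> 0 < e ->
  exists D H, [/\ compact D, compact H, D `<=` F, H `<=` ~` F &
    1 + lam C <= lam (C `|` D) + lam (C `|` H) + e].
Proof.
move=> cC cF e0; have e20 : 0 < e / 2 by rewrite divr_gt0.
have [B cB lB] := lam_tight e20.
have cBF : compact (B `&` F) by exact: compact_closedI.
have [U [oU DU mU]] := outer_content_approx (C `|` (B `&` F)) e20.
exists (B `&` F), (B `\` iota @^-1` U); split=> //.
- exact: compact_setD_preim.
- by move=> x [Bx nUx] Fx; apply: nUx; apply: DU; right.
have : 1 - e / 2 + lam C - m U <= lam (C `|` (B `\` iota @^-1` U)).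
  apply: outer_content_ge => G oG CG.
  have lBUG : lam B <= m (U `|` G).
    apply: outer_content_le => [|x Bx]; first exact: openU.
    have [Ux|nUx] := pselect (U (iota x)); first by left.
    by right; apply: CG; right.
  have lCUG : lam C <= m (U `&` G).
    by apply: outer_content_le => [|x Cx]; [exact: openI | split;
      [apply: DU; left | apply: CG; left]].
  by rewrite lerBlDl -(m_modular oU oG) lerD// (le_trans lB).
set x := lam (_ `|` (B `\` _)) => hx.
lra.
Qed.

(** The mass outside the best compact set that avoids E: the outer measure whose
    values on complements are inner approximations by compact sets, so that
    inner regularity is built in. *)
Definition co_content (E : set T) : \bar R :=
  ereal_inf [set (1 - lam C)%:E | C in [set C | compact C /\ C `&` E = set0]].

Local Notation mu := co_content.

Let mu_le C E : compact C -> C `&` E = set0 -> (mu E <= (1 - lam C)%:E)%E.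
Proof. by move=> cC CE0; apply: ereal_inf_lbound; exists C. Qed.

Let mu_ge E c :
  (forall C, compact C -> C `&` E = set0 -> (c <= (1 - lam C)%:E)%E) ->
  (c <= mu E)%E.
Proof. by move=> h; apply: le_ereal_inf_tmp => _ [C [cC CE0] <-]; exact: h. Qed.

Let mu_ge0 E : (0 <= mu E)%E.
Proof. by apply: mu_ge => C _ _; rewrite lee_fin subr_ge0. Qed.

Let mu_le1 E : (mu E <= 1)%E.
Proof.
apply: (le_trans (mu_le (@compact0 T) _)); first by rewrite set0I.
by rewrite lee_fin gerBl.
Qed.

Let mu_fin E : mu E \is a fin_num.
Proof. by rewrite ge0_fin_numE// (le_lt_trans (mu_le1 E))// ltry. Qed.

Let mu_approx E e : 0 < e -> exists C, [/\ compact C, C `&` E = set0 &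
  ((1 - lam C)%:E <= mu E + e%:E)%E].
Proof.
move=> e0; have := @lb_ereal_inf_adherent _ _ _ e0 (mu_fin E).
by move=> [_ [C [cC CE] <-] /ltW h]; exists C.
Qed.

Let mu0 : mu set0 = 0%E.
Proof.
apply/eqP; rewrite eq_le mu_ge0 andbT; apply/lee_addgt0Pr => e e0.
have [D cD lD] := lam_tight e0; rewrite add0e.
by apply: (le_trans (mu_le cD (setI0 _))); rewrite lee_fin lerBlDr -lerBlDl.
Qed.

Let mu_mono : {homo mu : A B / A `<=` B >-> (A <= B)%E}.
Proof.
move=> A B AB; apply: mu_ge => C cC CB0; apply: mu_le => //.
by apply: subsetI_eq0 CB0.
Qed.

Let lam_bigcap_finite (C : nat -> set T) n : (forall i, compact (C i)) ->
  1 - lam (\bigcap_(i < n.+1) C i) <= \sum_(i < n.+1) (1 - lam (C i)).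
Proof.
move=> cC; have cI k : compact (\bigcap_(i < k.+1) C i).
  apply: (@subclosed_compact _ _ (C 0%N)) => //; last by move=> x /(_ 0%N); apply.
  by apply: closed_bigI => i _; exact: compact_closed.
elim: n => [|n ih].
  by rewrite big_ord1 bigcap_mkord big_ord1.
rewrite big_ord_recr/= bigcap_mkord big_ord_recr/= -bigcap_mkord.
have := outer_content_setI (cI n) (cC n.+1); lra.
Qed.

Let mu_subadd : sigma_subadditive mu.
Proof.
move=> F; have [->|finS] := eqVneq (\sum_(i <oo) mu (F i))%E +oo%E.
  exact: leey.
apply/lee_addgt0Pr => e e0.
have /choice[C CP] : forall i, exists C, [/\ compact C, C `&` F i = set0 &
    ((1 - lam C)%:E <= mu (F i) + (e / 2 / (2 ^ i.+1)%:R)%:E)%E].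
  by move=> i; apply: mu_approx; rewrite !divr_gt0// ltr0n expn_gt0.
have cC i : compact (C i) by have [] := CP i.
have CF i : C i `&` F i = set0 by have [] := CP i.
have lC i : ((1 - lam (C i))%:E <= mu (F i) + (e / 2 / (2 ^ i.+1)%:R)%:E)%E.
  by have [] := CP i.
have cI : compact (\bigcap_i C i).
  apply: (@subclosed_compact _ _ (C 0%N)) => //; last by move=> x /(_ 0%N); apply.
  by apply: closed_bigI => i _; exact: compact_closed.
have : (mu (\bigcup_n F n) <= (1 - lam (\bigcap_i C i))%:E)%E.
  apply: mu_le => //; rewrite -subset0 => x [Cx [i _ Fx]].
  by rewrite -(CF i); split=> //; exact: Cx.
move=> /le_trans; apply.
have e20 : 0 < e / 2 by rewrite divr_gt0.
have [n ln] := outer_content_bigcap cC e20.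
(* countably many compact sets are replaced by the finitely many that give
   almost the same intersection *)
have fin_le := lam_bigcap_finite n cC.
have : ((1 - lam (\bigcap_i C i))%:E <=
    (\sum_(i < n.+1) (1 - lam (C i)))%:E + (e / 2)%:E)%E.
  by rewrite -EFinD lee_fin; lra.
move=> /le_trans; apply.
rewrite [in leRHS](splitr e) EFinD addeA leeD2r//.
apply: le_trans (epsilon_trick xpredT (fun i => mu_ge0 (F i)) (ltW e20)).
apply: le_trans (nneseries_lim_ge n.+1 _); last first.
  by move=> i _; rewrite adde_ge0// lee_fin !divr_ge0// ltW.
by rewrite big_mkord -sumEFin; apply: lee_sum.
Qed.

Let outer_mu : {outer_measure set (pointed_at x0) -> \bar R} :=
  HB.pack_for {outer_measure set (pointed_at x0) -> \bar R} mu
    (isOuterMeasure.Build R (pointed_at x0) mu mu0 mu_ge0 mu_mono mu_subadd).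

Let closed_caratheodory (F : set T) :
  closed F -> outer_mu.-caratheodory F.
Proof.
move=> cF; apply: le_caratheodory_measurable => X.
apply: mu_ge => C cC CX0; apply/lee_addgt0Pr => e e0.
have [D [H [cD cH DF HF DH]]] := outer_content_split cC cF e0.
have XF : (mu (X `&` F) <= (1 - lam (C `|` H))%:E)%E.
  apply: mu_le; first exact: compactU.
  rewrite -subset0 => x [[Cx|/HF Fx] [Xx ?]] //.
  by rewrite -CX0.
have XnF : (mu (X `&` ~` F) <= (1 - lam (C `|` D))%:E)%E.
  apply: mu_le; first exact: compactU.
  rewrite -subset0 => x [[Cx|/DF Fx] [Xx ?]] //.
  by rewrite -CX0.
apply: (le_trans (leeD XF XnF)); rewrite -!EFinD lee_fin; lra.
Qed.

Let borel_caratheodory : @measurable _ (borel x0) `<=` outer_mu.-caratheodory.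
Proof.
apply: smallest_sub; first exact: (@sigma_algebra_measurable _ (caratheodory_type outer_mu)).
move=> U oU; rewrite -(setCK U); apply: caratheodory_measurable_setC.
by apply: closed_caratheodory; exact: open_closedC.
Qed.

Let nu (B : set (borel x0)) : \bar R := mu B.

Let nu_sigma_additive : semi_sigma_additive nu.
Proof.
move=> F mF tF mUF.
have := @caratheodory_measure_sigma_additive R _ outer_mu F.
by apply=> // [i|]; apply: borel_caratheodory.
Qed.

Let nu_measure : {measure set (borel x0) -> \bar R} :=
  HB.pack_for {measure set (borel x0) -> \bar R} nu
    (isMeasure.Build _ (borel x0) R nu mu0 mu_ge0 nu_sigma_additive).

Let nu_setT : nu_measure setT = 1%E.
Proof.
apply/eqP; rewrite eq_le mu_le1/=; apply: mu_ge => C _; rewrite setIT => ->.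
rewrite lee_fin lerBrDr gerDl -m_set0; apply: outer_content_le => //.
exact: open0.
Qed.

Let closed_measurable (F : set (borel x0)) :
  closed (F : set T) -> measurable F.
Proof.
move=> cF; rewrite -(setCK F); apply: measurableC.
by apply: sub_sigma_algebra; exact: closed_openC.
Qed.

Let nuE B : nu_measure B = (fine (mu B))%:E.
Proof. by rewrite fineK. Qed.

Let mu_setC (B : set (borel x0)) : measurable B ->
  fine (mu B) + fine (mu (~` B)) = 1.
Proof.
move=> mB; apply: EFin_inj; rewrite EFinD -!nuE -nu_setT -(setUv B).
by rewrite measureU ?setICr//; exact: measurableC.
Qed.

Let content_le_nu C : compact C -> ((lam C)%:E <= nu_measure C)%E.
Proof.
move=> cC; have mC : measurable (C : set (borel x0)).
  by apply: closed_measurable; exact: compact_closed.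
have := mu_setC mC; have := mu_le cC (setICr C).
by rewrite nuE -(fineK (mu_fin (~` C))) !lee_fin; lra.
Qed.

Let nu_approx (B : set (borel x0)) e : measurable B -> 0 < e ->
  exists C, [/\ compact (C : set T), C `<=` B &
    (nu_measure B <= (lam C)%:E + e%:E)%E].
Proof.
move=> mB e0; have [C [cC CB0]] := mu_approx (~` B) e0.
have := mu_setC mB; rewrite nuE -(fineK (mu_fin (~` B))) -!EFinD !lee_fin.
move=> hB hC; exists C; split=> //; last by rewrite lee_fin; lra.
by move/disjoints_subset: CB0; rewrite setCK.
Qed.

(** The last clause transports a lower bound of m on the neighbourhoods of a
    compact set to the measure; the third one is the only upper bound. *)
Lemma radon_of_content : exists nu : {measure set (borel x0) -> \bar R},
  [/\ radon nu, nu setT = 1%E,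
      forall U, open U -> (nu (iota @^-1` U) <= (m U)%:E)%E &
      forall D c, compact D ->
        (forall U, open U -> D `<=` iota @^-1` U -> c <= m U) ->
        (c%:E <= nu D)%E].
Proof.
exists nu_measure; split=> //.
- split=> [x|B mB].
    exists setT; first by split=> //; exact: openT.
    by rewrite nu_setT ltry.
  apply/eqP; rewrite eq_le; apply/andP; split.
    apply/lee_addgt0Pr => e e0; have [C [cC CB hC]] := nu_approx mB e0.
    apply: (le_trans hC); rewrite leeD2r//; apply: (le_trans (content_le_nu cC)).
    by apply: ereal_sup_ubound; exists C.
  apply: ge_ereal_sup => _ [C [cC CB] <-]; apply: le_measure => //; rewrite inE//.
  by apply: closed_measurable; exact: compact_closed.
- move=> U oU; apply/lee_addgt0Pr => e e0.
  have mU : measurable (iota @^-1` U : set (borel x0)).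
    by apply: sub_sigma_algebra; exact: iota_open.
  have [C [cC CU hC]] := nu_approx mU e0; apply: (le_trans hC).
  by rewrite leeD2r// lee_fin; exact: outer_content_le.
- move=> D c cD h; apply: le_trans (content_le_nu cD).
  by rewrite lee_fin; exact: outer_content_ge.
Qed.

End RadonFromContent.

(** * Character spaces and ultralimits of characters *)

Section InitialTopology.
Context (R : realType) (T : choiceType) (I : Type) (f : I -> T -> R).

Let S : topologicalType :=
  sup_topology (fun i => Topological.class (initial_topology (f i))).

Lemma cvg_initial_family (F : set_system T) (t : S) : Filter F ->
  (forall i, f i @ F --> f i t) -> F --> t.
Proof.
move=> FF Ff; apply/cvg_sup => i; move=> A /=.
rewrite (@nbhsE (initial_topology (f i))) => -[_ [[B oB <-] Bt] BA].
apply: filterS BA _; apply: (Ff i B).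
exact: open_nbhs_nbhs.
Qed.

Lemma initial_family_continuous i : continuous (f i : S -> R).
Proof.
move=> t.
have /cvg_sup/(_ i) : (nbhs (t : S)) --> (t : S) by exact: cvg_id.
by move=> h A /(@initial_continuous _ _ (f i) t)/h.
Qed.

End InitialTopology.

Lemma hausdorff_separating (R : realType) (T : topologicalType) (I : Type)
    (f : I -> T -> R) :
  (forall i, continuous (f i)) ->
  (forall x y, (forall i, f i x = f i y) -> x = y) -> hausdorff_space T.
Proof.
move=> cf sep x y xy; apply: sep => i.
apply: (@Rhausdorff R) => A B nA nB.
have [z [Az Bz]] := xy _ _ (cf i _ _ nA) (cf i _ _ nB).
by exists (f i z).
Qed.

Section Ultralimits.
Context (R : realType) (I : Type) (F : set_system I).
Context {FU : UltraFilter F}.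

Lemma ultrafilter_cvg_bounded (u : I -> R) (M : R) :
  (\forall i \near F, `|u i| <= M) -> exists l : R, u @ F --> l.
Proof.
move=> uM; have FP : ProperFilter (u @ F) by exact: fmap_proper_filter.
have uFM : (u @ F) `[- M, M]%classic.
  by apply: filterS uM => i /=; rewrite in_itv/= ler_norml.
have [l [_ cl]] := segment_compact FP uFM.
exists l => A /= lA; have [//|nA] := in_ultra_setVsetC (u @^-1` A) FU.
by have [x [] //] := cl (~` A) A nA lA.
Qed.

(** The elements with eventually bounded values form a subalgebra, so that
    boundedness need only be checked on generators. *)
Lemma eventually_bounded_generated (A : comAlgType R) (V : {pred A})
    (y : I -> A -> R) :
  generated_by V ->
  (forall v, v \in V -> exists M, \forall i \near F, `|y i v| <= M) ->
  (forall c a b, \forall i \near F, y i (c *: a + b) = c * y i a + y i b) ->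
  (forall a b, \forall i \near F, y i (a * b) = y i a * y i b) ->
  (\forall i \near F, y i 1 = 1) ->
  forall a, exists M, \forall i \near F, `|y i a| <= M.
Proof.
move=> [G GV genA] yV yL yM y1 a.
suff : [set a | exists M, \forall i \near F, `|y i a| <= M] a by [].
have /set_mem := genA a; apply; split; last by move=> g /GV; exact: yV.
split.
- by rewrite inE; exists 1; apply: filterS y1 => i ->; rewrite normr1.
- move=> c u v; rewrite !inE => -[M uM] [N vN]; exists (`|c| * M + N).
  near=> i; rewrite (near (yL c u v))// (le_trans (ler_normD _ _))// lerD//.
    by rewrite normrM ler_wpM2l//; near: i.
  by near: i.
- move=> u v; rewrite !inE => -[M uM] [N vN]; exists (M * N).
  near=> i; rewrite (near (yM u v))// normrM ler_pM//; by near: i.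
Unshelve. all: by end_near. Qed.

(** Algebraic identities that hold eventually for the y i hold exactly in the
    limit, so that each y i may be a character of a subalgebra only, extended by
    zero. *)
Lemma ultralimit_character (A : comAlgType R) (y : I -> A -> R) :
  (forall a, exists M, \forall i \near F, `|y i a| <= M) ->
  (forall c a b, \forall i \near F, y i (c *: a + b) = c * y i a + y i b) ->
  (forall a b, \forall i \near F, y i (a * b) = y i a * y i b) ->
  (\forall i \near F, y i 1 = 1) ->
  exists alpha : character A, forall a, y ^~ a @ F --> hat a alpha.
Proof.
move=> yB yL yM y1.
have /choice[al alP] : forall a, exists l : R, y ^~ a @ F --> l.
  by move=> a; have [M /ultrafilter_cvg_bounded] := yB a.
have uniq (u v : I -> R) (k l : R) : (\forall i \near F, u i = v i) ->
    u @ F --> k -> v @ F --> l -> k = l.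
  move=> uv uk vl; apply: (cvg_unique (@Rhausdorff R) uk).
  by apply: cvg_trans vl; apply: near_eq_cvg; apply: filterS uv.
have alL : linear_for *%R al.
  move=> c a b; apply: uniq (yL c a b) (alP _) _.
  by apply: cvgD => //; apply: cvgMr.
have alM : monoid_morphism al.
  split; first by apply: uniq y1 (alP 1) _; exact: cvg_cst.
  by move=> a b; apply: uniq (yM a b) (alP _) _; exact: cvgM.
pose alpha : {lrmorphism A -> R | *%R} :=
  HB.pack_for {lrmorphism A -> R | *%R} al
    (GRing.isLinear.Build R A R *%R al alL)
    (GRing.isMonoidMorphism.Build A R al alM).
by exists alpha.
Qed.

End Ultralimits.

Section Characters.
Context (R : realType) (A : comAlgType R).
Implicit Types alpha beta : character A.

Lemma hat_continuous (a : A) : continuous (hat a : character A -> R).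
Proof. exact: (@initial_family_continuous R (character A) A (@hat R A) a). Qed.

Lemma cvg_character (F : set_system (character A)) alpha : Filter F ->
  (forall a, hat a @ F --> hat a alpha) -> F --> alpha.
Proof. exact: (@cvg_initial_family R (character A) A (@hat R A) F alpha). Qed.

Lemma character_ext alpha beta : (forall a, hat a alpha = hat a beta) -> alpha = beta.
Proof.
case: alpha beta => [f [[+] [+] [+]]] [g [[+] [+] [+]]] /= fg.
have {}fg : f = g by apply/funext. subst g.
move=> n1 m1 s1 n2 m2 s2.
by rewrite (Prop_irrelevance n1 n2) (Prop_irrelevance m1 m2)
  (Prop_irrelevance s1 s2).
Qed.

Lemma character_hausdorff : hausdorff_space (character A).
Proof. exact: (hausdorff_separating hat_continuous character_ext). Qed.

Lemma K_of_closed (Q : set A) : closed (K_of Q).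
Proof.
rewrite [K_of Q](_ : _ = \bigcap_(a in Q) (hat a : _ -> R) @^-1` [set x | 0 <= x]).
  apply: closed_bigI => a _; apply: (preimage_closed _ (@closed_ge _ _)).
  by move=> ? _; exact: hat_continuous.
by apply/seteqP; split.
Qed.

(** An ultrafilter on this set converges pointwise, because the bounds on V bound
    all elements of the algebra that V generates. *)
Lemma compact_bounded_characters (V : {pred A}) (K : set (character A))
    (b : A -> R) : generated_by V -> closed K ->
  compact (K `&` [set alpha | forall v, v \in V -> `|hat v alpha| <= b v]).
Proof.
move=> genV cK; set B := [set alpha | _]; rewrite compact_ultra => F FU FKB.
have FK : F K by apply: filterS FKB => ? [].
have FB : F B by apply: filterS FKB => ? [].
have [||||alpha Falpha] := @ultralimit_character R _ F _ A
    (fun (beta : character A) a => hat a beta).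
- apply: (eventually_bounded_generated genV).
  + by move=> v vV; exists (b v); apply: filterS FB => beta; exact.
  + by move=> c u v; apply: nearW => beta; rewrite /hat linearP.
  + by move=> u v; apply: nearW => beta; rewrite /hat rmorphM.
  + by apply: nearW => beta; rewrite /hat rmorph1.
- by move=> c u v; apply: nearW => beta; rewrite /hat linearP.
- by move=> u v; apply: nearW => beta; rewrite /hat rmorphM.
- by apply: nearW => beta; rewrite /hat rmorph1.
have Fa : F --> alpha by exact: cvg_character.
exists alpha; split=> //; split.
  by apply: cK => N /Fa FN; exact: filter_ex (filterI FK FN).
move=> v vV; have /cvg_norm hv := Falpha v.
apply: (closed_cvg (fun x => x <= b v)) hv.
- exact: closed_le.
- by apply: filterS FB => beta; exact.
Qed.

End Characters.

(** * Positive semidefinite forms on finite dimensional subspaces *)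

Section LinearSpan.
Context (R : realType) (U : lmodType R).
Implicit Types (s : seq U) (P : set U).

(** Coefficients are indexed by positions and not by vectors, in order that
    repetitions in s be harmless. *)
Definition lspan s : set U :=
  [set w | exists c : 'I_(size s) -> R, w = \sum_(i < size s) c i *: s`_i].

Lemma lspan_closed s : submod_closed [in lspan s].
Proof.
split; first by rewrite inE; exists (fun=> 0); rewrite big1// => i _; rewrite scale0r.
move=> a u v; rewrite !inE => -[c ->] [d ->]; exists (fun i => a * c i + d i).
rewrite scaler_sumr -big_split/=; apply: eq_bigr => i _.
by rewrite scalerDl scalerA.
Qed.

Lemma lspan_sub s P :
  submod_closed [in P] -> (forall x, x \in s -> P x) -> lspan s `<=` P.
Proof.
move=> [P0 PL] sP w [c ->]; apply/set_mem; elim/big_ind : _ => //.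
  by move=> u v Pu Pv; rewrite -[u]scale1r PL.
move=> i _; rewrite -[_ *: _]addr0 PL//; apply/mem_set/sP.
by rewrite mem_nth.
Qed.

Lemma mem_lspan s x : x \in s -> lspan s x.
Proof.
move=> xs; have ix : (index x s < size s)%N by rewrite index_mem.
exists (fun i => (i == Ordinal ix)%:R); rewrite (bigD1 (Ordinal ix))//= eqxx.
rewrite scale1r nth_index// big1 ?addr0// => i /negPf ->.
by rewrite scale0r.
Qed.

Lemma lspanP s c u v : lspan s u -> lspan s v -> lspan s (c *: u + v).
Proof.
by move=> su sv; apply/set_mem/(lspan_closed s).2; apply/mem_set.
Qed.

Lemma lspan_subset s t : {subset s <= t} -> lspan s `<=` lspan t.
Proof.
by move=> st; apply: lspan_sub (lspan_closed _) _ => x /st; exact: mem_lspan.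
Qed.

Lemma lspan_sum s (t : seq U) (c : U -> R) : {subset t <= s} ->
  lspan s (\sum_(x <- t) c x *: x).
Proof.
move=> ts; rewrite big_seq; elim/big_ind : _.
- exact/set_mem/(lspan_closed s).1.
- by move=> u v su sv; rewrite -[u]scale1r; exact: lspanP.
- move=> x /ts xs; rewrite -[_ *: _]addr0; apply: lspanP; first exact: mem_lspan.
  exact/set_mem/(lspan_closed s).1.
Qed.

End LinearSpan.

Lemma sum_cauchy_schwarz (R : realType) (T : eqType) (s : seq T) (a b : T -> R) :
  (\sum_(x <- s) a x * b x) ^+ 2 <=
  (\sum_(x <- s) a x ^+ 2) * (\sum_(x <- s) b x ^+ 2).
Proof.
set A := \sum_(x <- s) a x ^+ 2; set D := \sum_(x <- s) b x ^+ 2.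
set C := \sum_(x <- s) a x * b x.
have A0 : 0 <= A by apply: sumr_ge0 => x _; exact: sqr_ge0.
(* the squared norm of A times the component of b orthogonal to a *)
have : 0 <= \sum_(x <- s) (A * b x - C * a x) ^+ 2.
  by apply: sumr_ge0 => x _; exact: sqr_ge0.
have -> : \sum_(x <- s) (A * b x - C * a x) ^+ 2 = A * (A * D - C ^+ 2).
  have sqE (k l : R) : \sum_(x <- s) (k * b x - l * a x) ^+ 2 =
      k ^+ 2 * D - 2 * k * l * C + l ^+ 2 * A.
    rewrite /D /C /A !mulr_sumr -sumrB -big_split/=.
    by apply: eq_bigr => x _; lra.
  by rewrite sqE; lra.
have [A00 _|A_gt0] := eqVneq A 0; last first.
  by rewrite pmulr_rge0 ?subr_ge0// lt_neqAle eq_sym A_gt0.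
have a0 x : x \in s -> a x = 0.
  move=> xs; apply/eqP; rewrite -sqrf_eq0.
  move: A00 => /eqP; rewrite /A psumr_eq0; last by move=> ? _; exact: sqr_ge0.
  by move=> /allP/(_ _ xs).
rewrite A00 mul0r /C big_seq big1 ?expr0n// => x xs.
by rewrite a0 ?mul0r.
Qed.

Section GramSchmidt.
Context (R : realType) (U : lmodType R) (B : {biscalar U}).
Hypothesis B_sym : forall u v, B u v = B v u.
Hypothesis B_ge0 : forall u, 0 <= B u u.

Let BPl c u v w : B (c *: u + v) w = c * B u w + B v w.
Proof. exact: linearPl. Qed.

Let BPr c u v w : B w (c *: u + v) = c * B w u + B w v.
Proof. exact: linearPr. Qed.

Let BZl c u w : B (c *: u) w = c * B u w.
Proof. exact: linearZl_LR. Qed.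

Let BZr c u w : B w (c *: u) = c * B w u.
Proof. exact: linearZr. Qed.

Let BsumZl (e : seq U) (c : U -> R) w :
  B (\sum_(x <- e) c x *: x) w = \sum_(x <- e) c x * B x w.
Proof.
elim: e => [|x e ih]; first by rewrite !big_nil linear0l.
by rewrite !big_cons BPl ih.
Qed.

Lemma psd_null_orthogonal z u : B z z = 0 -> B z u = 0.
Proof.
move=> Bz; apply/eqP/negPn/negP => Bzu.
(* B (t z + u) (t z + u) = 2 t B z u + B u u takes the value -1 at this t *)
pose t := - (B u u + 1) / (2 * B z u).
have := B_ge0 (t *: z + u).
rewrite BPl !BPr (B_sym u z) Bz mulr0 add0r.
have -> : t * B z u + (t * B z u + B u u) = - 1.
  have -> : t * B z u = - (B u u + 1) / 2.
    by rewrite /t invfM mulrA -mulrA mulVf// mulr1.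
  by lra.
by rewrite oppr_ge0 ler10.
Qed.

(** The form may be degenerate, so a vector whose orthogonal component is null
    goes to z instead of being normalised. *)
Lemma gram_schmidt (s : seq U) : exists e z : seq U,
  [/\ uniq e, {in e &, forall x y, B x y = (x == y)%:R},
      {in z, forall x, B x x = 0} & forall x, x \in s -> lspan (e ++ z) x].
Proof.
elim: s => [|v s [e [z [ue oe nz sez]]]]; first by exists [::], [::].
pose w := v - \sum_(x <- e) B v x *: x.
have vE : v = w + \sum_(x <- e) B v x *: x by rewrite subrK.
have we x : x \in e -> B w x = 0.
  move=> xe; rewrite /w linearBl/= BsumZl (bigD1_seq x)//=.
  rewrite (oe x x)// eqxx mulr1 big_seq_cond big1 ?addr0 ?subrr//.
  by move=> y /andP[ye yx]; rewrite (oe y x)// (negPf yx) mulr0.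
have [Bw|Bw] := eqVneq (B w w) 0.
  exists e, (w :: z); split=> //.
    by move=> x; rewrite inE => /predU1P[->//|]; exact: nz.
  have sub : {subset e ++ z <= e ++ w :: z}.
    by move=> y; rewrite !mem_cat in_cons => /orP[->//|->]; rewrite !orbT.
  move=> x; rewrite inE => /predU1P[->|/sez]; last exact: lspan_subset.
  have -> : v = 1 *: w + \sum_(x <- e) B v x *: x by rewrite scale1r.
  apply: lspanP.
    by apply: mem_lspan; rewrite mem_cat mem_head orbT.
  by apply: lspan_sum => y ye; rewrite mem_cat ye.
have Bw_gt0 : 0 < B w w by rewrite lt_neqAle eq_sym Bw B_ge0.
pose r := Num.sqrt (B w w); have r_gt0 : 0 < r by rewrite sqrtr_gt0.
pose f := r^-1 *: w.
have fe x : x \in e -> B f x = 0 by move=> xe; rewrite BZl we// mulr0.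
have ff : B f f = 1.
  rewrite BZl BZr mulrA -invfM -expr2 sqr_sqrtr ?ltW//.
  by rewrite mulVf.
have nfe : f \notin e.
  by apply/negP => fie; have := fe _ fie; rewrite ff => /eqP; rewrite oner_eq0.
exists (f :: e), z; split=> //=; first by rewrite nfe.
  move=> x y; rewrite !inE => /predU1P[->|xe] /predU1P[->|ye].
  - by rewrite ff eqxx.
  - by rewrite fe//; case: eqP => // fy; rewrite fy ye in nfe.
  - by rewrite B_sym fe//; case: eqP => // xf; rewrite -xf xe in nfe.
  - exact: oe.
have sub : {subset e ++ z <= f :: e ++ z} by move=> y; rewrite inE orbC => ->.
move=> x; rewrite inE => /predU1P[->|/sez]; last exact: lspan_subset.
have -> : v = r *: f + \sum_(x <- e) B v x *: x.
  by rewrite scalerA mulfV ?scale1r ?gt_eqF.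
apply: lspanP; first by apply: mem_lspan; rewrite inE eqxx.
by apply: lspan_sum => y ye; rewrite inE mem_cat ye orbT.
Qed.

Lemma orthonormal_expansion (e z : seq U) :
  uniq e -> {in e &, forall x y, B x y = (x == y)%:R} ->
  {in z, forall x, B x x = 0} ->
  forall w, lspan (e ++ z) w -> lspan z (w - \sum_(x <- e) B w x *: x).
Proof.
move=> ue oe nz; apply: lspan_sub.
  split; rewrite ?inE /=.
    rewrite sub0r big1 ?oppr0; first exact/set_mem/(lspan_closed z).1.
    by move=> x _; rewrite linear0l scale0r.
  move=> a u v; rewrite !inE /= => hu hv.
  have := lspanP a hu hv; congr lspan.
  rewrite scalerBr scaler_sumr addrACA -opprD -big_split/=; congr (_ - _).
  by apply: eq_bigr => x _; rewrite BPl scalerDl scalerA.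
move=> x; rewrite mem_cat => /orP[xe|xz].
  rewrite (bigD1_seq x)//= oe// eqxx scale1r big_seq_cond big1 ?addr0 ?subrr.
    exact/set_mem/(lspan_closed z).1.
  by move=> y /andP[ye yx]; rewrite oe// eq_sym (negPf yx) scale0r.
rewrite big1 ?subr0; first exact: mem_lspan.
by move=> y _; rewrite psd_null_orthogonal ?nz// scale0r.
Qed.

Lemma orthonormal_norm (e z : seq U) :
  uniq e -> {in e &, forall x y, B x y = (x == y)%:R} ->
  {in z, forall x, B x x = 0} ->
  forall w, lspan (e ++ z) w -> \sum_(x <- e) B w x ^+ 2 = B w w.
Proof.
move=> ue oe nz w ezw; have zw := orthonormal_expansion ue oe nz ezw.
set n := w - _ in zw.
have Bn : B n w = 0.
  apply: (@lspan_sub _ _ z [set u | B u w = 0]) zw => [|x xz]; last by apply: psd_null_orthogonal; exact: nz.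
  split; first by rewrite inE/= linear0l.
  by move=> a u v; rewrite !inE/= BPl => -> ->; rewrite mulr0 addr0.
move: Bn; rewrite linearBl/= => /eqP; rewrite subr_eq0 => /eqP ->.
by rewrite BsumZl; apply: eq_bigr => x _; rewrite expr2 (B_sym x).
Qed.

(** A functional that kills the null vectors is determined by its values on the
    orthonormal ones, and the Cauchy-Schwarz inequality bounds its dual norm.
    Linearity is only required on the span. *)
Lemma functional_bound (e z : seq U) (y : U -> R) (c : R) :
  uniq e -> {in e &, forall x y, B x y = (x == y)%:R} ->
  {in z, forall x, B x x = 0} -> 0 <= c ->
  (forall k u v, lspan (e ++ z) u -> lspan (e ++ z) v ->
    y (k *: u + v) = k * y u + y v) ->
  {in z, forall x, y x = 0} -> \sum_(x <- e) y x ^+ 2 <= c ^+ 2 ->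
  forall w, lspan (e ++ z) w -> `|y w| <= c * Num.sqrt (B w w).
Proof.
move=> ue oe nz c0 yL yz yc w ezw.
have span0 : lspan (e ++ z) 0 by exact/set_mem/(lspan_closed _).1.
have y0 : y 0 = 0 by have := yL 1 0 0 span0 span0; rewrite scaler0 addr0; lra.
have [ezn yn] : [set u | lspan (e ++ z) u /\ y u = 0]
    (w - \sum_(x <- e) B w x *: x).
  apply: lspan_sub (orthonormal_expansion ue oe nz ezw) => [|x xz].
    split; first by rewrite inE.
    move=> k u v; rewrite !inE => -[su yu] [sv yv]; split; first exact: lspanP.
    by rewrite yL// yu yv mulr0 addr0.
  by split; [apply: mem_lspan; rewrite mem_cat xz orbT | exact: yz].
set n := w - _ in ezn yn.
have ysum (e' : seq U) : {subset e' <= e} ->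
    lspan (e ++ z) (\sum_(x <- e') B w x *: x + n) /\
    y (\sum_(x <- e') B w x *: x + n) = \sum_(x <- e') B w x * y x.
  elim: e' => [|x e' ih] sub; first by rewrite !big_nil add0r.
  have [ih1 ih2] : lspan (e ++ z) (\sum_(x <- e') B w x *: x + n) /\
    y (\sum_(x <- e') B w x *: x + n) = \sum_(x <- e') B w x * y x.
    by apply: ih => u ue'; apply: sub; rewrite inE ue' orbT.
  have sx : lspan (e ++ z) x.
    by apply: mem_lspan; rewrite mem_cat sub ?mem_head.
  by rewrite !big_cons -addrA yL// ih2; split=> //; exact: lspanP.
have yw : y w = \sum_(x <- e) B w x * y x.
  by rewrite -(ysum e _).2// /n addrC subrK.
have Bw := sqrtr_ge0 (B w w).
rewrite -(ler_pXn2r (_ : 0 < 2)%N) ?nnegrE ?mulr_ge0// real_normK ?num_real//.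
rewrite yw (le_trans (sum_cauchy_schwarz _ _ _))// (orthonormal_norm ue oe nz ezw).
by rewrite exprMn sqr_sqrtr// mulrC ler_wpM2r.
Qed.

End GramSchmidt.

(** * Layer sums, superlevel sets and Borel measures *)

(** The sum of e over the k with k e < x approximates x >= 0 from above with error
    at most e.  Integrating it compares the integral of f with finitely many measures
    of superlevel sets; finite sums pass to limits along ultrafilters, for which
    the convergence theorems of sequences of functions are of no help. *)
Section LayerSums.
Context (R : realType).
Implicit Types (e : R) (n : nat).

Lemma layer_sum_le (x : R) e n : 0 <= x -> 0 < e ->
  \sum_(k < n) e * (k%:R * e < x)%R%:R <= x + e.
Proof.
move=> x0 e0.
suff : \sum_(k < n) e * (k%:R * e < x)%R%:R <= n%:R * e /\
       \sum_(k < n) e * (k%:R * e < x)%R%:R <= x + e by case.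
elim: n => [|n [ih1 ih2]]; first by rewrite big_ord0 mul0r addr_ge0// ltW.
rewrite big_ord_recr/= -natr1 mulrDl mul1r.
case: ltP => [nx|_]; rewrite ?mulr1 ?mulr0 ?addr0; split; lra.
Qed.

Lemma layer_sum_ge (x : R) e n : 0 < e -> x <= n%:R * e ->
  x <= \sum_(k < n) e * (k%:R * e < x)%R%:R.
Proof.
move=> e0 xn.
suff : n%:R * e <= \sum_(k < n) e * (k%:R * e < x)%R%:R \/
       x <= \sum_(k < n) e * (k%:R * e < x)%R%:R by case=> //; exact: le_trans.
elim: n {xn} => [|n ih]; first by left; rewrite big_ord0 mul0r.
rewrite big_ord_recr/= -natr1 mulrDl mul1r.
case: ltP ih => [nx|nx] [] ih; rewrite ?mulr1 ?mulr0 ?addr0.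
- by left; lra.
- by right; lra.
- by right; lra.
- by right.
Qed.

Context d (T : measurableType d) (mu : {measure set T -> \bar R}) (f : T -> R).
Hypothesis mf : measurable_fun setT f.
Hypothesis f0 : forall x, 0 <= f x.

Let level c : set T := [set x | c < f x].

Lemma measurable_superlevel c : measurable [set x | c < f x].
Proof.
rewrite [X in measurable X](_ : _ = setT `&` f @^-1` `]c, +oo[%classic).
  exact: mf.
by rewrite setTI; apply/seteqP; split=> x /=; rewrite in_itv/= andbT.
Qed.

Let layer e k : set T := level (k%:R * e).

Let indic_level e k x :
  (e * \1_(layer e k) x = e * (k%:R * e < f x)%R%:R)%R.
Proof.
rewrite indicE; congr (_ * (_ : bool)%:R).
by apply/idP/idP; [move/set_mem | move=> h; apply/mem_set].
Qed.

Let integral_layer e k : 0 < e ->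
  (\int[mu]_x (e * \1_(layer e k) x)%:E =
   e%:E * mu (layer e k))%E.
Proof.
move=> e0; rewrite (@integralZl_indic _ _ _ mu setT _ (fun=> layer e k))//.
- by rewrite integral_indic// ?setIT//; exact: measurable_superlevel.
- by move=> /lt_trans/(_ e0); rewrite ltxx.
- exact: measurable_superlevel.
Qed.

Let measurable_layer e k :
  measurable_fun setT (fun x => (e * \1_(layer e k) x)%:E).
Proof.
apply/measurable_EFinP; apply: measurable_funM => //.
by apply: measurable_indic; exact: measurable_superlevel.
Qed.

Let layer_ge0 e k x : 0 < e -> (0 <= (e * \1_(layer e k) x)%:E)%E.
Proof. by move=> e0; rewrite lee_fin mulr_ge0// ltW. Qed.

Lemma layer_sum_le_integral e n : 0 < e ->
  (\sum_(k < n) e%:E * mu [set x | (k%:R * e < f x)%R]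
   <= \int[mu]_x (f x)%:E + e%:E * mu setT)%E.
Proof.
move=> e0; rewrite -integral_cst// -ge0_integralD//; first last.
- by move=> x _; rewrite lee_fin ltW.
- exact/measurable_EFinP.
- by move=> x _; rewrite lee_fin.
under eq_bigr do rewrite -integral_layer//.
rewrite -(big_mkord xpredT (fun k => \int[mu]_x (e * \1_(layer e k) x)%:E))%E.
rewrite -ge0_integral_sum//; last by move=> *; exact: layer_ge0.
apply: ge0_le_integral => //.
- by move=> x _; apply: sume_ge0 => k _; exact: layer_ge0.
- by apply: emeasurable_sum.
- by apply: emeasurable_funD => //; exact/measurable_EFinP.
move=> x _; rewrite big_mkord sumEFin lee_fin.
by under eq_bigr do rewrite indic_level; exact: layer_sum_le.
Qed.

Lemma integral_le_layer_sums e c : 0 < e ->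
  (forall n, \sum_(k < n) e%:E * mu [set x | (k%:R * e < f x)%R] <= c)%E ->
  (\int[mu]_x (f x)%:E <= c)%E.
Proof.
move=> e0 hc.
apply: (@le_trans _ _
    (\int[mu]_x (\sum_(k <oo) (e * \1_(layer e k) x)%:E))%E).
  apply: ge0_le_integral => //.
  - by move=> x _; rewrite lee_fin.
  - exact/measurable_EFinP.
  - apply: ge0_emeasurable_sum => //.
    by move=> k x _ _; exact: layer_ge0.
  move=> x _; pose n := (Num.truncn (f x / e)).+1.
  apply: le_trans (@nneseries_lim_ge _ _ _ 0 n _); last first.
    by move=> k _ _; exact: layer_ge0.
  rewrite big_mkord sumEFin lee_fin.
  under eq_bigr do rewrite indic_level.
  apply: layer_sum_ge => //; rewrite -ler_pdivrMr//.
  by apply: ltW; apply: truncnS_gt.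
rewrite integral_nneseries//; last by move=> *; exact: layer_ge0.
apply: lime_le.
  by apply: is_cvg_nneseries => k _ _; apply: integral_ge0 => x _; exact: layer_ge0.
apply: nearW => n; rewrite big_mkord.
by under eq_bigr do rewrite integral_layer//; exact: hc.
Qed.

Lemma markov_superlevel c : 0 <= c ->
  (c%:E * mu [set x | (c < f x)%R] <= \int[mu]_x (f x)%:E)%E.
Proof.
move=> c0; have ml := measurable_superlevel c; rewrite -integral_cst//.
apply: (@le_trans _ _ (\int[mu]_(x in level c) (f x)%:E)%E).
  apply: ge0_le_integral => //.
  - by apply/measurable_EFinP; exact: measurable_funTS.
  - by move=> x; rewrite lee_fin => /ltW.
apply: ge0_subset_integral => //; first exact/measurable_EFinP.
by move=> x _; rewrite lee_fin.
Qed.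

Lemma integral0_superlevel : (\int[mu]_x (f x)%:E = 0)%E ->
  mu [set x | 0 < f x] = 0%E.
Proof.
move=> if0; have lvl0 k : mu (level k.+1%:R^-1) = 0%E.
  have k0 : 0 < k.+1%:R^-1 :> R by rewrite invr_gt0.
  have := markov_superlevel (ltW k0); rewrite if0.
  rewrite pmule_rle0 ?lte_fin// => h.
  by apply/eqP; rewrite eq_le h measure_ge0.
have -> : [set x | 0 < f x] = \bigcup_k level k.+1%:R^-1.
  apply/seteqP; split=> x /=.
    move=> fx; exists (Num.truncn (f x)^-1) => //; rewrite /level/=.
    by rewrite invf_plt ?posrE// ?truncnS_gt.
  by move=> [k _]; rewrite /level/=; apply: lt_trans.
apply/negligibleP.
  by apply: bigcupT_measurable => k; exact: measurable_superlevel.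
apply: negligible_bigcup => k.
by apply/negligibleP; [exact: measurable_superlevel | exact: lvl0].
Qed.

End LayerSums.

Section BorelMeasures.
Context (R : realType) (T : topologicalType) (x0 : T).

Lemma open_borel (U : set T) : open U -> measurable (U : set (borel x0)).
Proof. by move=> oU; exact: sub_sigma_algebra. Qed.

Lemma closed_borel (F : set T) : closed F -> measurable (F : set (borel x0)).
Proof.
move=> cF; rewrite -(setCK F); apply: measurableC.
by apply: open_borel; exact: closed_openC.
Qed.

Lemma continuous_borel (f : T -> R) :
  continuous f -> measurable_fun setT (f : borel x0 -> R).
Proof.
move=> /continuousP cf; apply: (measurability _ (RGenOpens.measurableE R)).
move=> _ [_ [a [b ->] <-]]; rewrite setTI; apply: open_borel.
exact/cf/interval_open.
Qed.

(** Inner regularity gives compact subsets of the complement of the support, and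
    these are covered by finitely many null open sets. *)
Lemma radon_supp_null (nu : {measure set (borel x0) -> \bar R}) (F : set T) :
  hausdorff_space T -> radon nu -> closed F -> supp nu `<=` F -> nu (~` F) = 0%E.
Proof.
move=> T2 [_ inn] cF sF; rewrite (inn (~` F)); last first.
  by apply: open_borel; exact: closed_openC.
apply/eqP; rewrite eq_le; apply/andP; split; last first.
  apply: ereal_sup_ubound; exists set0 => //.
  by split; [exact: compact0 | exact: sub0set].
apply: ge_ereal_sup => _ [C [cC CF] <-].
have : @compact (pointed_at x0) C by [].
rewrite compact_cover => /(_ _ [set U | open U /\ nu U = 0%E] id) [].
- by move=> U [].
- move=> x Cx; have : ~ supp nu x by move=> /sF; exact: CF.
  move=> /existsNP[G /not_implyP[[[cG nG] _] nGx]].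
  exists (~` G) => //; split=> //; exact: closed_openC.
move=> D DU CD.
pose W := \big[setU/set0]_(U <- finmap.enum_fset D) (U : set (borel x0)).
have [mW nW] : measurable W /\ nu W = 0%E.
  rewrite /W big_seq; elim/big_ind : _ => //.
  - move=> A B [mA nA] [mB nB]; split; first exact: measurableU.
    apply/eqP; rewrite eq_le measure_ge0 andbT.
    apply: (le_trans (measureU2 nu mA mB)).
    by rewrite /= [X in (X + _)%E]nA [X in (_ + X)%E]nB adde0.
  - move=> U /DU /set_mem[oU nU]; split=> //; exact: open_borel.
rewrite (subset_measure0 _ mW _ nW)//.
  by apply: closed_borel; exact: compact_closed.
rewrite /W -bigcup_fset => x /CD[U DUx Ux].
by exists U.
Qed.

End BorelMeasures.

(** * Representing measures *)

Section RepresentingMeasures.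
Context (R : realType) (A : comAlgType R) (x0 : character A).
Context (nu : {measure set (borel x0) -> \bar R}).

Lemma hat_measurable (a : A) : measurable_fun setT (hat a : borel x0 -> R).
Proof. by apply: continuous_borel; exact: hat_continuous. Qed.

Lemma hat_sqr (a : A) (alpha : character A) :
  hat (a ^+ 2) alpha = hat a alpha ^+ 2.
Proof. by rewrite /hat rmorphXn. Qed.

Lemma hat_sum_sqr (s : seq A) (alpha : character A) :
  hat (\sum_(x <- s) x ^+ 2) alpha = \sum_(x <- s) hat x alpha ^+ 2.
Proof.
by rewrite /hat rmorph_sum; apply: eq_bigr => x _; rewrite rmorphXn.
Qed.

Lemma representing_setT (L : A -> R) :
  representing L nu -> nu setT = (L 1)%:E.
Proof.
move=> /(_ 1)[_ ->]; rewrite -[LHS]mul1e -integral_cst//.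
by apply: eq_integral => x _; rewrite /hat rmorph1.
Qed.

Lemma representing_null (L : A -> R) (a : A) : representing L nu ->
  (forall alpha, 0 <= hat a alpha) -> L a = 0 ->
  nu [set alpha | 0 < hat a alpha] = 0%E.
Proof.
move=> rep a0 La; apply: integral0_superlevel => //; first exact: hat_measurable.
by rewrite -(rep a).2 La.
Qed.

Lemma representing_markov (L : A -> R) (a : A) c : representing L nu ->
  (forall alpha, 0 <= hat a alpha) -> 0 < c ->
  (nu [set alpha | (c < hat a alpha)%R] <= (L a / c)%:E)%E.
Proof.
move=> rep a0 c0; have := markov_superlevel nu (hat_measurable a) a0 (ltW c0).
by rewrite -(rep a).2 mulrC EFinM lee_pdivlMl.
Qed.

(** Markov inequality for the sum of the squares of e: the exceptional set is
    the union of a set of measure at most t / c and of the null set where some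
    element of z does not vanish. *)
Lemma small_characters_measure (L : {scalar A}) (e z : seq A) (t c : R) :
  representing L nu -> {in z, forall x, L (x ^+ 2) = 0} ->
  \sum_(x <- e) L (x ^+ 2) <= t -> 0 < c ->
  exists G : set (borel x0), [/\ measurable G, (nu (~` G) <= (t / c)%:E)%E,
    forall beta x, G beta -> x \in z -> hat x beta = 0 &
    forall beta, G beta -> \sum_(x <- e) hat x beta ^+ 2 <= c].
Proof.
move=> rep Lz Le c0.
pose a := \sum_(x <- e) x ^+ 2; pose b := \sum_(x <- z) x ^+ 2.
have sq0 (s : seq A) (beta : character A) : 0 <= hat (\sum_(x <- s) x ^+ 2) beta.
  by rewrite hat_sum_sqr; apply: sumr_ge0 => x _; exact: sqr_ge0.
pose E1 : set (borel x0) := [set beta | c < hat a beta].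
pose E2 : set (borel x0) := [set beta | 0 < hat b beta].
have mE1 : measurable E1 by apply: measurable_superlevel; exact: hat_measurable.
have mE2 : measurable E2 by apply: measurable_superlevel; exact: hat_measurable.
exists (~` (E1 `|` E2)); split.
- by apply: measurableC; exact: measurableU.
- rewrite setCK; apply: (le_trans (measureU2 nu mE1 mE2)).
  have Lb : L b = 0 by rewrite raddf_sum big_seq big1// => x xz; rewrite Lz.
  rewrite /= [X in (_ + X)%E](representing_null rep (sq0 z) Lb) adde0.
  apply: (le_trans (representing_markov rep (sq0 e) c0)).
  by rewrite lee_fin ler_pM2r ?invr_gt0// raddf_sum.
- move=> beta x /not_orP[_ /negP]; rewrite -leNgt hat_sum_sqr => sz xz.
  apply/eqP; rewrite -sqrf_eq0; move: xz.
  have : \sum_(y <- z) hat y beta ^+ 2 == 0.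
    by rewrite eq_le sz -hat_sum_sqr sq0.
  rewrite psumr_eq0; last by move=> y _; exact: sqr_ge0.
  by move=> /allP h xz; exact: h.
- by move=> beta /not_orP[/negP]; rewrite -leNgt hat_sum_sqr.
Qed.

(** Expanding the hypothesis for c = a + t turns it into an inequality between
    two quadratic polynomials in t with the same leading coefficient, so that
    their linear coefficients 2 L(a) and twice the mean of a coincide. *)
Lemma representing_of_squares (L : {scalar A}) :
  nu setT = 1%E -> L 1 = 1 ->
  (forall c, (\int[nu]_alpha (hat c alpha ^+ 2)%:E <= (L (c ^+ 2))%:E)%E) ->
  representing L nu.
Proof.
move=> nuT L1 le2.
have nu_fin : fin_num_fun nu.
  by apply: lty_fin_num_fun; rewrite nuT ltry.
have int2 a : nu.-integrable setT (EFin \o hat (a ^+ 2)).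
  apply/integrableP; split; first by apply/measurable_EFinP; exact: hat_measurable.
  apply: (@le_lt_trans _ _ (L (a ^+ 2))%:E); last exact: ltry.
  apply: le_trans (le2 a); rewrite le_eqVlt; apply/orP; left; apply/eqP.
  by apply: eq_integral => x _ /=; rewrite hat_sqr ger0_norm// sqr_ge0.
have icst (r : R) : nu.-integrable setT (EFin \o cst r).
  apply/integrableP; split; first exact/measurable_EFinP.
  under eq_integral do rewrite /=.
  by rewrite integral_cst// nuT mule1 ltry.
have int1 a : nu.-integrable setT (EFin \o hat a).
  have ig : nu.-integrable setT
      (fun x => (1%:E + (hat (a ^+ 2) x)%:E)%E).
    exact: (integrableD measurableT (icst 1) (int2 a)).
  apply: le_integrable ig => //.
    by apply/measurable_EFinP; exact: hat_measurable.
  move=> x _ /=; rewrite lee_fin hat_sqr [leRHS]ger0_norm; last first.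
    by rewrite addr_ge0// sqr_ge0.
  have := sqr_ge0 (`|hat a x| - 1); rewrite sqrrB1 real_normK ?num_real//.
  by have := normr_ge0 (hat a x); lra.
pose I a := (\int[nu]_x hat a x)%R.
have IE a : (I a)%:E = (\int[nu]_x (hat a x)%:E)%E.
  by rewrite /I /Rintegral fineK//; exact: (integrable_fin_num measurableT (int1 a)).
move=> a; split=> //; rewrite -IE; congr EFin.
have ID b c : I (b + c) = I b + I c.
  rewrite /I -RintegralD//; apply: eq_Rintegral => x _.
  by rewrite /hat rmorphD.
have IZ r b : I (r *: b) = r * I b.
  rewrite /I -RintegralZl//; apply: eq_Rintegral => x _.
  by rewrite /hat linearZ.
have I1 : I 1 = 1.
  rewrite /I; under eq_Rintegral do rewrite /hat rmorph1.
  by rewrite Rintegral_cst// nuT mulr1.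
have key t : I (a ^+ 2) + 2 * t * I a + t ^+ 2 <=
    L (a ^+ 2) + 2 * t * L a + t ^+ 2.
  have aE : (a + t *: 1) ^+ 2 = a ^+ 2 + (2 * t) *: a + t ^+ 2 *: 1.
    rewrite sqrrD exprZn expr1n; congr (_ + _ + _).
    by rewrite -scalerAr mulr1 -scaler_nat scalerA.
  have LE : L ((a + t *: 1) ^+ 2) = L (a ^+ 2) + 2 * t * L a + t ^+ 2.
    by rewrite aE !linearD !linearZ/= L1 mulr1.
  have IEt : I ((a + t *: 1) ^+ 2) = I (a ^+ 2) + 2 * t * I a + t ^+ 2.
    by rewrite aE !ID !IZ I1 mulr1.
  rewrite -LE -IEt -lee_fin IE; apply: le_trans (le2 _).
  by under eq_integral do rewrite hat_sqr.
apply/eqP/negPn/negP => neq.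
have neq0 : I a - L a != 0 by rewrite subr_eq0 eq_sym.
(* at this t the inequality [key] reads d <= d - 1 *)
pose d := L (a ^+ 2) - I (a ^+ 2) + 1.
have := key (d / (2 * (I a - L a))).
set u := d / _; have : 2 * u * (I a - L a) = d.
  have -> : 2 * u * (I a - L a) = u * (2 * (I a - L a)) by lra.
  by rewrite /u divfK// mulf_neq0// pnatr_eq0.
by rewrite /d; lra.
Qed.

End RepresentingMeasures.

(** * Characters of subalgebras as points of one product space *)

Section ExtensionByZero.
Context (R : realType) (A : comAlgType R).

Definition zero_extension (S : subalgClosed A)
    (beta : character (subalg_type S)) : {ptws A -> R} :=
  fun a => if insub a is Some u then hat (u : subalg_type S) beta else 0.

Lemma zero_extension_val (S : subalgClosed A) (beta : character (subalg_type S))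
    (u : subalg_type S) : zero_extension beta (val u) = hat u beta.
Proof. by rewrite /zero_extension valK. Qed.

Lemma zero_extensionP (S : subalgClosed A) (beta : character (subalg_type S))
    (a : A) : a \in S ->
  exists2 u : subalg_type S, val u = a & zero_extension beta a = hat u beta.
Proof.
move=> aS; exists (exist _ a aS) => //.
exact: (zero_extension_val beta (exist _ a aS)).
Qed.

Lemma zero_extensionL (S : subalgClosed A) (beta : character (subalg_type S))
    (c : R) (a b : A) : a \in S -> b \in S ->
  zero_extension beta (c *: a + b) =
  c * zero_extension beta a + zero_extension beta b.
Proof.
move=> /(zero_extensionP beta)[u <- ->] /(zero_extensionP beta)[v <- ->].
by rewrite -[_ + _]/(val (c *: u + v)) zero_extension_val /hat linearP.
Qed.

Lemma zero_extensionM (S : subalgClosed A) (beta : character (subalg_type S))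
    (a b : A) : a \in S -> b \in S ->
  zero_extension beta (a * b) = zero_extension beta a * zero_extension beta b.
Proof.
move=> /(zero_extensionP beta)[u <- ->] /(zero_extensionP beta)[v <- ->].
by rewrite -[_ * val _]/(val (u * v)) zero_extension_val /hat rmorphM.
Qed.

Lemma zero_extension1 (S : subalgClosed A) (beta : character (subalg_type S)) :
  zero_extension beta 1 = 1.
Proof.
by rewrite -[1 in LHS]/(val (1 : subalg_type S)) zero_extension_val /hat rmorph1.
Qed.

Lemma ptws_eval_continuous (a : A) : continuous (fun y : {ptws A -> R} => y a).
Proof.
exact: (@initial_family_continuous R (A -> R) A (fun a y => y a) a).
Qed.

Lemma ptws_sqr_gt_open (a : A) (t : R) :
  open [set y : {ptws A -> R} | t < y a ^+ 2].
Proof.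
rewrite [X in open X](_ : _ = (fun y : {ptws A -> R} => y a) @^-1`
    [set x : R | t < x ^+ 2])//.
apply: open_comp => [y _|]; first exact: ptws_eval_continuous.
rewrite [X in open X](_ : _ = (fun x : R => x ^+ 2) @^-1` [set x | t < x])//.
by apply: open_comp; [move=> x _; exact: exprn_continuous | exact: open_gt].
Qed.

Lemma ptws_cvg (T : Type) (F : set_system T) (f : T -> {ptws A -> R})
    (y : {ptws A -> R}) : Filter F ->
  (forall a, (fun t => f t a) @ F --> y a) -> f @ F --> y.
Proof.
move=> FF h.
exact: (@cvg_initial_family R (A -> R) A (fun a y => y a) (f @ F) y).
Qed.

Lemma ptws_hausdorff : hausdorff_space {ptws A -> R}.
Proof.
apply: (@hausdorff_separating R {ptws A -> R} A (fun a y => y a)).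
  exact: ptws_eval_continuous.
by move=> x y; exact: funext.
Qed.

Lemma zero_extension_continuous (S : subalgClosed A) :
  continuous (@zero_extension S).
Proof.
move=> beta; apply: (@ptws_cvg _ (nbhs _) _ _ (nbhs_filter _)) => a.
rewrite /zero_extension; case: insubP => [u _ _|_]; first exact: hat_continuous.
exact: cvg_cst.
Qed.

Lemma hat_ptws_continuous :
  continuous (fun alpha : character A => (fun a => hat a alpha) : {ptws A -> R}).
Proof. by move=> alpha; apply: (@ptws_cvg _ (nbhs _) _ _ (nbhs_filter _)) => a; exact: hat_continuous. Qed.

End ExtensionByZero.

(** * The limit of a tight family of representing measures *)

Section ProjectiveLimit.
Context (R : realType) (A : comAlgType R) (x0 : character A).
Context (V : {pred A}) (Q : set A) (L : {scalar A}).
Context (I : Type) (F : set_system I) {FU : UltraFilter F}.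
Context (S : I -> subalgClosed A) (W : I -> set A).
Context (nu : forall i,
  {measure set (borel (res_character (S i) x0)) -> \bar R}).
Hypothesis genV : generated_by V.
Hypothesis L1 : L 1 = 1.
Hypothesis nu_rep : forall i,
  representing (fun a : subalg_type (S i) => L (val a)) (nu i).
Hypothesis S_near : forall a, \forall i \near F, a \in S i.
Hypothesis W_near : forall v, v \in V -> \forall i \near F, W i v.

(** Positivity on Q and the bound b cut out of every X(S i) the counterpart of one
    and the same compact subset of X(A); here it carries all but e of the mass of
    each nu i. *)
Definition tight_bound (e : R) (b : A -> R) : Prop := forall i,
  exists G : set (borel (res_character (S i) x0)),
    [/\ measurable G, (nu i (~` G) <= e%:E)%E &
        forall beta : character (subalg_type (S i)), G beta -> forall u : subalg_type (S i),
          (Q (val u) -> 0 <= hat u beta) /\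
          (W i (val u) -> `|hat u beta| <= b (val u))].

Hypothesis tight : forall e, 0 < e -> exists b, tight_bound e b.

Let X_le (b : A -> R) : set (character A) :=
  K_of Q `&` [set alpha | forall v, v \in V -> `|hat v alpha| <= b v].

Let P i (U : set {ptws A -> R}) : R :=
  fine (nu i (@zero_extension _ _ (S i) @^-1` U)).

Let nu_setT i : nu i setT = 1%E.
Proof. by rewrite (representing_setT (@nu_rep i))/= L1. Qed.

Let measurable_pre i (U : set {ptws A -> R}) : open U ->
  measurable (@zero_extension _ _ (S i) @^-1` U : set (borel (res_character (S i) x0))).
Proof.
move=> oU; apply: open_borel; apply: open_comp => // beta _.
exact: zero_extension_continuous.
Qed.

Let nu_le1 i G : measurable G -> (nu i G <= 1)%E.
Proof. by move=> mG; rewrite -(nu_setT i) le_measure ?inE. Qed.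

Let nu_fin i G : measurable G -> nu i G \is a fin_num.
Proof.
by move=> mG; rewrite ge0_fin_numE// (le_lt_trans (nu_le1 mG))// ltry.
Qed.

Let PE i U : open U -> (P i U)%:E = nu i (@zero_extension _ _ (S i) @^-1` U).
Proof. by move=> oU; rewrite fineK// nu_fin//; exact: measurable_pre. Qed.

Let P_ge0 i U : 0 <= P i U.
Proof. exact: fine_ge0. Qed.

Let P_le1 i U : open U -> P i U <= 1.
Proof. by move=> oU; rewrite -lee_fin PE// nu_le1//; exact: measurable_pre. Qed.

Let limit_content (U : set {ptws A -> R}) : R := lim (P ^~ U @ F).
Local Notation m := limit_content.

Let m_cvg U : open U -> P ^~ U @ F --> m U.
Proof.
move=> oU; have [|l Pl] := @ultrafilter_cvg_bounded R I F _ (P ^~ U) 1.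
  by apply: nearW => i; rewrite ger0_norm ?P_le1.
exact: (cvgP l).
Qed.

Let m_le U c : open U -> (\forall i \near F, P i U <= c) -> m U <= c.
Proof.
by move=> oU h; apply: (closed_cvg (fun x => x <= c)) (m_cvg oU) => //; exact: closed_le.
Qed.

Let m_ge U c : open U -> (\forall i \near F, c <= P i U) -> c <= m U.
Proof.
by move=> oU h; apply: (closed_cvg (fun x => c <= x)) (m_cvg oU) => //; exact: closed_ge.
Qed.

Let m_modular U U' : open U -> open U' ->
  m (U `|` U') + m (U `&` U') = m U + m U'.
Proof.
move=> oU oU'.
have hl : (fun i => P i (U `|` U') + P i (U `&` U')) @ F -->
    m (U `|` U') + m (U `&` U').
  by apply: cvgD; apply: m_cvg; [exact: openU | exact: openI].
have hr : (fun i => P i U + P i U') @ F --> m U + m U'.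
  by apply: cvgD; exact: m_cvg.
apply: (cvg_unique (@Rhausdorff R) hl); apply: cvg_trans hr.
apply: near_eq_cvg; apply: nearW => i /=; apply: EFin_inj.
rewrite !EFinD !PE//; [|exact: openI|exact: openU].
rewrite preimage_setU preimage_setI measureUfinr; [|exact: measurable_pre..|].
  by rewrite subeK// nu_fin//; apply: measurableI; exact: measurable_pre.
by rewrite (le_lt_trans (nu_le1 _))// ?ltry//; exact: measurable_pre.
Qed.

(** Otherwise almost every i would have a character of S i in G i but outside U;
    the ultralimit of these characters lies in [X_le b], hence in U, and then so do
    almost all of them. *)
Let near_in_open e b (U : set {ptws A -> R}) : tight_bound e b -> open U ->
  X_le b `<=` [set alpha | U (fun a => hat a alpha)] ->
  \forall i \near F, 1 - e <= P i U.
Proof.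
move=> tb oU bU.
pose G i := projT1 (cid (tb i)); have GP i := projT2 (cid (tb i)).
pose good i := G i `<=` @zero_extension _ _ (S i) @^-1` U.
have [Fgood|Fbad] := in_ultra_setVsetC [set i | good i] FU.
  apply: filterS Fgood => i gi; have [mG nG _] := GP i.
  have mpU := @measurable_pre i _ oU.
  rewrite -lee_fin PE//; apply: (@le_trans _ _ (nu i (G i))); last first.
    by apply: le_measure; rewrite ?inE.
  have : (nu i (G i) + nu i (~` G i) = 1)%E.
    rewrite -(nu_setT i) -(setUv (G i)) measureU ?setICr//.
    exact: measurableC.
  move: nG; rewrite -(fineK (nu_fin mG)) -(fineK (nu_fin (measurableC mG))).
  by rewrite -EFinD !lee_fin => nG [] nGC; rewrite -/(G i) in nG; lra.
exfalso.
have /choice[y yP] : forall i, exists y : {ptws A -> R}, ~ good i ->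
    exists2 beta, G i beta & y = zero_extension beta /\ ~ U y.
  move=> i; have [gi|] := pselect (good i); first by exists (fun=> 0).
  move=> /existsNP[beta /not_implyP[Gb nU]].
  by exists (zero_extension beta) => _; exists beta.
have yQW (a : A) : \forall i \near F,
    (Q a -> 0 <= y i a) /\ (W i a -> `|y i a| <= b a).
  apply: filterS2 Fbad (S_near a) => i /yP[beta Gb [-> _]] aS.
  have [u <- ->] := zero_extensionP beta aS.
  by have [_ _ /(_ beta Gb u)] := GP i.
have yL (c : R) (a a' : A) : \forall i \near F,
    y i (c *: a + a') = c * y i a + y i a'.
  apply: filterS3 Fbad (S_near a) (S_near a') => i /yP[beta _ [-> _]].
  exact: zero_extensionL.
have yM (a a' : A) : \forall i \near F, y i (a * a') = y i a * y i a'.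
  apply: filterS3 Fbad (S_near a) (S_near a') => i /yP[beta _ [-> _]].
  exact: zero_extensionM.
have y1 : \forall i \near F, y i 1 = 1.
  apply: filterS Fbad => i /yP[beta _ [-> _]].
  exact: zero_extension1.
have yV v : v \in V -> \forall i \near F, `|y i v| <= b v.
  by move=> vV; apply: filterS2 (yQW v) (W_near vV) => i [_].
have [alpha ya] : exists alpha : character A, forall a, y ^~ a @ F --> hat a alpha.
  apply: ultralimit_character => //.
  apply: (eventually_bounded_generated genV) => // v vV.
  by exists (b v); exact: yV.
have aX : X_le b alpha.
  split=> [a Qa|v vV].
    apply: (closed_cvg (fun x : R => 0 <= x) (@closed_ge R 0) _ _ (ya a)).
    by apply: filterS (yQW a) => i [/(_ Qa)].
  have /cvg_norm := ya v; apply: (closed_cvg (fun x : R => x <= b v)).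
    exact: closed_le.
  exact: yV.
have yU : y @ F --> ((fun a => hat a alpha) : {ptws A -> R}) by exact: ptws_cvg.
have FyU : F [set i | U (y i)] by apply: yU; apply: open_nbhs_nbhs; split=> //; exact: bU.
have [i [/yP[beta _ [_ nU]] Uy]] := filter_ex (filterI Fbad FyU).
exact: nU.
Qed.

Let X_le_compact b : compact (X_le b).
Proof. exact: (compact_bounded_characters (b := b) genV (@K_of_closed R A Q)). Qed.

Let m_tight e b : tight_bound e b -> forall U : set {ptws A -> R}, open U ->
  X_le b `<=` [set alpha | U (fun a => hat a alpha)] -> 1 - e <= m U.
Proof. by move=> tb U oU bU; apply: m_ge => //; exact: (near_in_open tb oU bU). Qed.

(** The bound holds for nu i as soon as c belongs to S i, and a finite sum of
    limits along F is a limit. *)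
Let layer_sum_limit c e n (U := fun k : nat =>
    [set y : {ptws A -> R} | k%:R * e < y c ^+ 2]) : 0 < e ->
  \sum_(k < n) e * m (U k) <= L (c ^+ 2) + e.
Proof.
move=> e0; have oU k : open (U k) by exact: ptws_sqr_gt_open.
have Pm : (fun i => \sum_(k < n) e * P i (U k)) @ F --> \sum_(k < n) e * m (U k).
  elim: n => [|n ih].
    by rewrite big_ord0; under eq_fun do rewrite big_ord0; exact: cvg_cst.
  rewrite big_ord_recr/=; under eq_fun do rewrite big_ord_recr/=.
  by apply: cvgD => //; apply: cvgMr; exact: m_cvg.
apply: (closed_cvg (fun x : R => x <= L (c ^+ 2) + e) (@closed_le R _) _ _ Pm).
apply: filterS (S_near c) => i cS.
have [u uc _] := zero_extensionP (res_character (S i) x0) cS.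
have sq0 (beta : character (subalg_type (S i))) : 0 <= hat (u ^+ 2) beta.
  by rewrite hat_sqr sqr_ge0.
have := layer_sum_le_integral (nu i) (@hat_measurable _ _ _ (u ^+ 2)) sq0 n e0.
rewrite -(@nu_rep i (u ^+ 2)).2 nu_setT mule1 -EFinD.
rewrite (_ : L (val (u ^+ 2)) = L (c ^+ 2)); last by rewrite rmorphXn/= uc.
rewrite -lee_fin -sumEFin; congr (_ <= _)%E; apply: eq_bigr => k _.
rewrite EFinM PE//; congr (_ * nu i _)%E; apply/seteqP.
by split=> beta /=; rewrite hat_sqr -zero_extension_val uc.
Qed.

(** The measures nu i live on different spaces and are compared only through the
    limit of their values on the open sets of the product space. *)
Lemma representing_of_tight_family : exists mu : {measure set (borel x0) -> \bar R},
  [/\ radon mu, representing L mu &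
    forall e b, tight_bound e b ->
      (mu (~` (K_of Q `&`
        [set alpha | forall v, v \in V -> (`|hat v alpha| <= b v)%R])) <= e%:E)%E].
Proof.
have hat_inj : injective (fun alpha : character A =>
    (fun a => hat a alpha) : {ptws A -> R}).
  by move=> alpha beta ab; apply: character_ext => a; exact: (congr1 (@^~ a) ab).
have [] := @radon_of_content R (character A) {ptws A -> R} x0
  (fun alpha => (fun a => hat a alpha)) m (@ptws_hausdorff R A)
  (@hat_ptws_continuous R A) hat_inj.
- by move=> U oU; apply: m_ge => //; apply: nearW => i; exact: P_ge0.
- have o0 : open (set0 : set {ptws A -> R}) by exact: open0.
  apply/eqP; rewrite eq_le (m_ge o0)/= ?andbT ?(m_le o0)//.
    by apply: nearW => i; rewrite /P preimage_set0 measure0.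
  by apply: nearW => i; exact: P_ge0.
- by move=> U oU; apply: m_le => //; apply: nearW => i; exact: P_le1.
- exact: m_modular.
- move=> e /tight[b tb]; exists (X_le b); first exact: X_le_compact.
  exact: m_tight tb.
move=> mu [mu_radon mu1 mu_open mu_compact]; exists mu; split=> //; last first.
  move=> e b tb; have cX := @X_le_compact b.
  have mX : measurable (X_le b : set (borel x0)).
    by apply: closed_borel; apply: compact_closed => //; exact: character_hausdorff.
  have := mu_compact _ _ cX (m_tight tb).
  have : (mu (X_le b) + mu (~` X_le b) = 1)%E.
    by rewrite -mu1 -(setUv (X_le b)) measureU ?setICr//; exact: measurableC.
  have mu_fin (G : set (borel x0)) : measurable G -> mu G \is a fin_num.
    move=> mG; rewrite ge0_fin_numE// (@le_lt_trans _ _ 1%E) ?ltry//.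
    by rewrite -mu1 le_measure ?inE.
  rewrite -/(X_le b) -(fineK (mu_fin _ mX)) -(fineK (mu_fin _ (measurableC mX))).
  by rewrite -EFinD !lee_fin => -[]; lra.
apply: representing_of_squares => // c; apply/lee_addgt0Pr => e e0.
rewrite -EFinD.
have mf : measurable_fun setT (fun alpha : borel x0 => hat (c ^+ 2) alpha).
  exact: hat_measurable.
under eq_integral do rewrite -hat_sqr.
apply: (integral_le_layer_sums mf _ e0) => [alpha|n].
  by rewrite hat_sqr sqr_ge0.
have := layer_sum_limit c n e0; rewrite -lee_fin; apply: le_trans.
rewrite -sumEFin; apply: lee_sum => k _; rewrite EFinM lee_pmul2l//.
apply: le_trans (mu_open _ (ptws_sqr_gt_open _ _)).
rewrite [X in (mu X <= _)%E](_ : _ = [set alpha | k%:R * e < hat c alpha ^+ 2])//.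
by apply/seteqP; split=> alpha /=; rewrite hat_sqr.
Qed.

End ProjectiveLimit.

(** * The trace condition and finitely generated subalgebras *)

Section Trace.
Context (R : realType) (U : lmodType R) (p q : U -> R) (B : {biscalar U}).
Hypothesis Bq : induces B q.

Lemma trace_bound : (tr p q < +oo)%E ->
  (forall v, q v = 0 -> p v = 0) /\
  exists2 t : R, 0 <= t & forall e : seq U, uniq e ->
    {in e &, forall x y, B x y = (x == y)%:R} -> \sum_(x <- e) p x ^+ 2 <= t.
Proof.
rewrite /tr; case: asboolP => // ker_qp; set T := ereal_sup _ => T_lt.
have T_ge (e : seq U) : uniq e -> {in e &, forall x y, B x y = (x == y)%:R} ->
    ((\sum_(x <- e) p x ^+ 2)%:E <= T)%E.
  move=> ue oe; apply: ereal_sup_ubound; exists [set` e].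
    by split; [exact: finite_seq | exists B].
  by rewrite -fsbig_seq.
have T0 : (0 <= T)%E by have := T_ge [::] isT; rewrite big_nil; apply.
split=> //; exists (fine T); first exact: fine_ge0.
by move=> e ue oe; rewrite -lee_fin fineK ?T_ge// ge0_fin_numE.
Qed.

End Trace.

Section FinitelyGenerated.
Context (R : realType) (A : comAlgType R) (V : submodClosed A).

Lemma lspan_val (b : seq (submod_type V)) (v : submod_type V) :
  lspan (map val b) (val v) <-> lspan b v.
Proof.
split; last first.
  apply: (@lspan_sub _ _ b [set v | lspan (map val b) (val v)]).
    split; first by rewrite inE; exact: (set_mem (lspan_closed (map val b)).1).
    by move=> k u w; rewrite !inE; exact: lspanP.
  by move=> x xb; apply: mem_lspan; exact: map_f.
have : lspan (map val b) `<=` [set val v | v in lspan b].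
  apply: lspan_sub.
    split; first by rewrite inE; exists 0 => //; exact: (set_mem (lspan_closed b).1).
    move=> k u w; rewrite !inE /= => -[u' bu' <-] [w' bw' <-].
    by exists (k *: u' + w'); [exact: lspanP | ].
  by move=> _ /mapP[x xb ->]; exists x => //; exact: mem_lspan.
by move=> /[apply] -[u bu /val_inj <-].
Qed.

Lemma lspan_val_sub (b : seq (submod_type V)) :
  lspan (map val b) `<=` [set` V].
Proof.
apply: lspan_sub => [|_ /mapP[x _ ->]]; last exact: valP.
split; rewrite ?inE /=; first exact: rpred0.
by move=> k u w; rewrite !inE /= => Vu Vw; apply: rpredD => //; exact: rpredZ.
Qed.

Definition span_algebra (b : seq (submod_type V)) : subalgClosed A :=
  gen_subalg (lspan (map val b)).

Lemma span_algebra_fg b : fg_subalgs V (span_algebra b).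
Proof.
exists (lspan (map val b)) => //; split; last exact: lspan_val_sub.
split; first exact: lspan_closed.
by exists (map val b) => // x xb; exact: mem_lspan.
Qed.

Lemma sub_gen_subalg (W : set A) a : W a -> a \in gen_subalg W.
Proof. by move=> Wa; apply/mem_set => T [_]; apply. Qed.

Lemma near_span_algebra (I : Type) (F : set_system I)
    (b : I -> seq (submod_type V)) : Filter F -> generated_by V ->
  (forall v, \forall i \near F, lspan (b i) v) ->
  forall a, \forall i \near F, a \in span_algebra (b i).
Proof.
move=> FF [G GV genA] bF a.
suff : [set a | \forall i \near F, a \in span_algebra (b i)] a by [].
have /set_mem := genA a; apply; split.
  split.
  - by rewrite inE; apply: nearW => i; exact: rpred1.
  - move=> k u v; rewrite !inE => bu bv; apply: filterS2 bu bv => i ? ?.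
    by apply: rpredD => //; exact: rpredZ.
  - move=> u v; rewrite !inE => bu bv; apply: filterS2 bu bv => i ? ?.
    exact: rpredM.
move=> g /GV Vg; apply: filterS (bF (exist _ g Vg)) => i bg.
apply: sub_gen_subalg.
exact: (lspan_val (b i) (exist _ g Vg)).2.
Qed.

End FinitelyGenerated.

Lemma sub_seq (T : Type) (P : {pred T}) (sT : subType P) (s : seq T) :
  all P s -> exists s' : seq sT, map val s' = s.
Proof.
elim: s => [|x s ih] /=; first by exists [::].
by move=> /andP[Px /ih[s' <-]]; exists (Sub x Px :: s'); rewrite /= SubK.
Qed.

Lemma inclusion_ultrafilter (T : eqType) : exists F : set_system (seq T),
  UltraFilter F /\ forall x, \forall s \near F, x \in s.
Proof.
pose F0 : set_system (seq T) :=
  filter_from setT (fun s : seq T => [set s' : seq T | {subset s <= s'}]).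
have F0P : ProperFilter F0.
  apply: filter_from_proper; last by move=> s _; exists s => /=.
  apply: filter_from_filter; first by exists [::].
  move=> s t _ _; exists (s ++ t) => // u /= stu.
  by split=> x xs; apply: stu; rewrite mem_cat xs ?orbT.
have [F [FU F0F]] := ultraFilterLemma F0P; exists F; split=> // x.
by apply: F0F; exists [:: x] => // s /= ->//; rewrite mem_head.
Qed.

Section SpanTightness.
Context (R : realType) (A : comAlgType R) (x0 : character A).
Context (V : submodClosed A) (L : {scalar A}) (Q : set A).
Context (q : submod_type V -> R) (B : {biscalar (submod_type V)}) (t c : R).
Context (e z : seq (submod_type V)).
Hypothesis Bq : induces B q.
Hypothesis e_uniq : uniq e.
Hypothesis e_orth : {in e &, forall x y, B x y = (x == y)%:R}.
Hypothesis z_null : {in z, forall x, B x x = 0}.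
Hypothesis Lz : {in z, forall x, L (val x ^+ 2) = 0}.
Hypothesis Le : \sum_(x <- e) L (val x ^+ 2) <= t.
Hypothesis c_gt0 : 0 < c.

Local Notation S := (span_algebra (e ++ z)).

(** The bound t / c ^ 2 depends on e and z only through t, hence is uniform over
    all finite dimensional subspaces of V. *)
Lemma span_tightness (nu : {measure set (borel (res_character S x0)) -> \bar R}) :
  radon nu -> representing (fun a : subalg_type S => L (val a)) nu ->
  supp nu `<=` K_of [set a : subalg_type S | Q (val a)] ->
  exists G : set (borel (res_character S x0)),
    [/\ measurable G, (nu (~` G) <= (t / c ^+ 2)%:E)%E &
      forall beta : character (subalg_type S), G beta ->
        forall u : subalg_type S,
          (Q (val u) -> 0 <= hat u beta) /\
          (forall v : submod_type V, val v = val u -> lspan (e ++ z) v ->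
            `|hat u beta| <= c * q v)].
Proof.
move=> nu_radon nu_rep nu_supp; have [B_sym B_ge0 qE] := Bq.
have sub (b : seq (submod_type V)) : {subset b <= e ++ z} ->
    exists bS : seq (subalg_type S), map val bS = map val b.
  move=> bez; apply: sub_seq; apply/allP => _ /mapP[x xb ->].
  apply: sub_gen_subalg; apply/lspan_val; apply: mem_lspan; exact: bez.
have [eS eSE] : exists bS : seq (subalg_type S), map val bS = map val e.
  by apply: sub => x xe; rewrite mem_cat xe.
have [zS zSE] : exists bS : seq (subalg_type S), map val bS = map val z.
  by apply: sub => x xz; rewrite mem_cat xz orbT.
have [G [mG nG Gz Ge]] : exists G : set (borel (res_character S x0)),
  [/\ measurable G, (nu (~` G) <= (t / c ^+ 2)%:E)%E,
    forall (beta : character (subalg_type S)) x, G beta -> x \in zS -> hat x beta = 0 &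
    forall beta : character (subalg_type S), G beta ->
      \sum_(x <- eS) hat x beta ^+ 2 <= c ^+ 2].
  pose LS : {scalar (subalg_type S)} := L \o val.
  apply: (small_characters_measure (L := LS)) => //; last exact: exprn_gt0.
    move=> x /(map_f val); rewrite zSE => /mapP[y yz xy].
    by rewrite -[LHS]/(L (val x ^+ 2)) xy; exact: Lz.
  apply: le_trans Le.
  have -> : \sum_(x <- e) L (val x ^+ 2) = \sum_(a <- map val e) L (a ^+ 2).
    by rewrite big_map.
  by rewrite -eSE big_map; exact: ler_sum.
set KS := K_of [set a : subalg_type S | Q (val a)] in nu_supp.
have cKS : closed KS by exact: K_of_closed.
have mKS : measurable (KS : set (borel (res_character S x0))) by exact: closed_borel.
exists (G `&` KS); split; first exact: measurableI.
  rewrite setCI; apply: (le_trans (measureU2 nu (measurableC mG) (measurableC mKS))).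
  rewrite /= [X in (_ + X)%E](radon_supp_null _ nu_radon cKS nu_supp) ?adde0//.
  exact: character_hausdorff.
move=> beta [Gbeta KSbeta] u; split=> [Qu|v vu ezv]; first exact: KSbeta.
pose y (w : submod_type V) : R := zero_extension beta (val w).
have wS w : lspan (e ++ z) w -> val w \in S.
  by move=> ezw; apply: sub_gen_subalg; apply/lspan_val.
have -> : hat u beta = y v by rewrite /y vu zero_extension_val.
rewrite qE; apply: (functional_bound B_sym B_ge0 e_uniq e_orth z_null) => //.
- exact: ltW.
- by move=> k w w' ezw ezw'; apply: zero_extensionL; exact: wS.
- move=> x xz; have : val x \in map val zS by rewrite zSE map_f.
  by move=> /mapP[x' zx' xx']; rewrite /y xx' zero_extension_val Gz.
- apply: le_trans (Ge beta Gbeta).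
  have -> : \sum_(x <- e) y x ^+ 2 =
      \sum_(a <- map val e) zero_extension beta a ^+ 2 by rewrite big_map.
  rewrite -eSE big_map.
  by apply: ler_sum => x _; rewrite zero_extension_val.
Qed.

End SpanTightness.

Theorem corollary2p12 (R : realType) (A : comAlgType R) (x0 : character A)
  (V : submodClosed A) (K : set (character A)) (L : {scalar A}) (Q : set A)
  (q : submod_type V -> R) :
  generated_by V ->
  closed K ->
  L 1 = 1 ->
  (forall a : A, 0 <= L (a ^+ 2)) ->
  quadratic_module Q ->
  K = K_of Q ->
  hilbertian q ->
  (tr (fun v : submod_type V => s_of L (val v)) q < +oo)%E ->
  continuous_characters K q !=set0 ->
  (forall S : subalgClosed A, fg_subalgs V S ->
     exists nu_S : {measure set (borel (res_character S x0)) -> \bar R},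
       [/\ radon nu_S,
           representing (fun a : subalg_type S => L (val a)) nu_S
         & supp nu_S `<=` K_of [set a : subalg_type S | Q (val a)]]) ->
  exists nu : {measure set (borel x0) -> \bar R},
    [/\ radon nu,
        representing L nu
      & nu (~` continuous_characters K q) = 0%E].
Proof.
move=> genV cK L1 L_ge0 _ KE [B Bq] tr_fin _ hS.
have [B_sym B_ge0 qE] := Bq.
have q_ge0 v : 0 <= q v by rewrite qE sqrtr_ge0.
have [ker_q [t t0 tr_le]] := trace_bound Bq tr_fin.
have sE (v : submod_type V) : s_of L (val v) ^+ 2 = L (val v ^+ 2).
  by rewrite sqr_sqrtr.
have /choice[ez ezP] : forall s : seq (submod_type V),
    exists ez : seq (submod_type V) * seq (submod_type V),
    [/\ uniq ez.1, {in ez.1 &, forall x y, B x y = (x == y)%:R},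
        {in ez.2, forall x, B x x = 0} &
        forall x, x \in s -> lspan (ez.1 ++ ez.2) x].
  by move=> s; have [e [z h]] := gram_schmidt B_sym B_ge0 s; exists (e, z).
(* the subspaces are indexed by finite lists s of vectors but spanned by the
   bases of Gram-Schmidt, which carry the trace bound *)
pose b s := (ez s).1 ++ (ez s).2.
have [F [FU F_mem]] := inclusion_ultrafilter (submod_type V).
have b_near v : \forall s \near F, lspan (b s) v.
  by apply: filterS (F_mem v) => s; have [_ _ _] := ezP s; apply.
pose nu s := projT1 (cid (hS _ (span_algebra_fg (b s)))).
have nuP s : [/\ radon (nu s),
    representing (fun a : subalg_type (span_algebra (b s)) => L (val a)) (nu s) &
    supp (nu s) `<=` K_of [set a : subalg_type (span_algebra (b s)) | Q (val a)]].
  exact: projT2 (cid (hS _ (span_algebra_fg (b s)))).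
pose bd (n : nat) (a : A) : R :=
  if insub a is Some v then n.+1%:R * q (v : submod_type V) else 0.
have bdE n (v : submod_type V) : bd n (val v) = n.+1%:R * q v.
  by rewrite /bd valK.
have tight n : tight_bound Q (fun s => lspan (map val (b s))) nu
    (t / n.+1%:R ^+ 2) (bd n).
  move=> s; have [ue oe nz _] := ezP s; have [nu_rad nu_rep nu_supp] := nuP s.
  have Lz : {in (ez s).2, forall x, L (val x ^+ 2) = 0}.
    move=> x /nz Bx; rewrite -sE ker_q ?expr0n//.
    by rewrite qE Bx sqrtr0.
  have Le : \sum_(x <- (ez s).1) L (val x ^+ 2) <= t.
    by under eq_bigr do rewrite -sE; exact: tr_le.
  have n0 : 0 < n.+1%:R :> R by [].
  have [G [mG nG GP]] := span_tightness Bq ue oe nz Lz Le n0 nu_rad nu_rep nu_supp.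
  exists G; split=> // beta Gbeta u; have [GQ Gq] := GP beta Gbeta u.
  split=> // bu; have Vu : val u \in V := lspan_val_sub bu.
  have uE : val u = val (exist _ (val u) Vu : submod_type V) by [].
  by rewrite uE bdE; apply: Gq => //; apply/lspan_val.
have small e : 0 < e -> exists n, t / n.+1%:R ^+ 2 <= e.
  (* with N = truncn (t / e) + 1 one has t < e N <= e N ^ 2 *)
  move=> e0; exists (Num.truncn (t / e)).
  have n1 : 1 <= (Num.truncn (t / e)).+1%:R :> R by rewrite ler1n.
  have := truncnS_gt (t / e); rewrite ltr_pdivrMr// => tn.
  rewrite ler_pdivrMr ?exprn_gt0// ?(lt_le_trans ltr01)// (le_trans (ltW tn))//.
  by rewrite mulrC ler_pM2l// expr2 ler_peMr// (le_trans ler01).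
have nu_rep s : representing
    (fun a : subalg_type (span_algebra (b s)) => L (val a)) (nu s).
  by have [] := nuP s.
have W_near a : a \in V -> \forall s \near F, lspan (map val (b s)) a.
  move=> Va; apply: filterS (b_near (exist _ a Va)) => s bs.
  exact: (lspan_val (b s) (exist _ a Va)).2.
have tight_all e : 0 < e ->
    exists bnd, tight_bound Q (fun s => lspan (map val (b s))) nu e bnd.
  move=> /small[n tn]; exists (bd n) => s; have [G [mG nG GP]] := tight n s.
  by exists G; split=> //; apply: le_trans nG _; rewrite lee_fin.
have [mu [mu_rad mu_rep mu_bd]] :=
  representing_of_tight_family genV L1 nu_rep (near_span_algebra _ genV b_near) W_near tight_all.
exists mu; split=> //.
pose X n := K_of Q `&`
  [set alpha : character A | forall v, v \in V -> `|hat v alpha| <= bd n v].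
have mX n : measurable (X n : set (borel x0)).
  apply: closed_borel; apply: compact_closed; first exact: character_hausdorff.
  exact: (compact_bounded_characters (b := bd n) genV (@K_of_closed R A Q)).
have ME : continuous_characters K q = \bigcup_n X n.
  apply/seteqP; split=> [alpha [Ka [C C0 aC]]|alpha [n _ [Ka an]]].
    exists (Num.truncn C) => //; split; first by rewrite -KE.
    move=> v Vv; have := aC (exist _ v Vv); rewrite /= => /le_trans; apply.
    rewrite -[v in bd _ v]/(val (exist _ v Vv : submod_type V)) bdE.
    by rewrite ler_wpM2r// ltW// truncnS_gt.
  split; first by rewrite KE.
  by exists n.+1%:R => // v; rewrite -bdE; exact: an (valP v).
apply/eqP; rewrite eq_le measure_ge0 andbT; apply/lee_addgt0Pr => e e0.
have [n tn] := small _ e0; rewrite add0e.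
apply: (@le_trans _ _ (mu (~` X n))).
  apply: le_measure; rewrite ?inE.
  - by rewrite ME; apply: measurableC; exact: bigcupT_measurable.
  - exact: measurableC.
  - by rewrite ME; apply: subsetC => alpha Xa; exists n.
by apply: (le_trans (mu_bd _ _ (tight n))); rewrite lee_fin.
Qed.
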